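(* Let $\mu$ be the Lebesgue measure restricted to $[0,1]$ and let $\rho=\frac12(\mu\times\delta_0+\delta_0\times\mu)$, a measure on $\mathbb{R}^2$. Among countable sets $\Lambda\subset\mathbb{R}^2$ with $(0,0)\in\Lambda$, the only one for which $E(\Lambda)$ is an orthonormal basis for $L^2(\rho)$ is $$\Lambda=\{(n/2,-n/2):n\in\mathbb{Z}\}.$$ (In particular, for this $\Lambda$, $E(\Lambda)$ is an orthonormal basis for $L^2(\rho)$.)
   Context: $\delta_0$ is the Dirac measure at $0$. Thus $\int F\,d\rho=\frac12\int_0^1F(x,0)\,dx+\frac12\int_0^1F(0,y)\,dy$ (the paper calls $L^2(\rho)$ the L Space). For $(a,b)\in\mathbb{R}^2$ let $e_{a,b}(x,y)=e^{2\pi i(ax+by)}$, and for a countable set $\Lambda\subset\mathbb{R}^2$ let $E(\Lambda)=\{e_{a,b}:(a,b)\in\Lambda\}$. *)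

(* Defs.v *)
From HB Require Import structures.
From mathcomp Require Import all_boot all_order all_algebra.
From mathcomp Require Import complex.
From mathcomp Require Import all_classical all_reals all_analysis.
From mathcomp Require Import measurable_realfun.

Set Implicit Arguments.
Unset Strict Implicit.
Unset Printing Implicit Defensive.

Import Order.TTheory GRing.Theory Num.Theory.
Import numFieldNormedType.Exports.

Local Open Scope classical_set_scope.
Local Open Scope ring_scope.

(* Elements of the complex space L^2(mu) are represented by functions T -> R[i],
   with mu-almost everywhere equality as equality. *)
Section ComplexL2.
Context d (T : measurableType d) (R : realType).
Variable mu : {measure set T -> \bar R}.
Implicit Types (f g : T -> R[i]) (S : set (T -> R[i])).

Definition cmeasurable f :=
  measurable_fun setT (@complex.Re R \o f) /\
  measurable_fun setT (@complex.Im R \o f).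

Definition L2norm f : \bar R :=
  Lnorm mu 2%:E (fun x => (ComplexField.Normc.normc (f x))%:E).

Definition L2 : set (T -> R[i]) :=
  [set f | cmeasurable f /\ (L2norm f < +oo)%E].

Definition Cintegral f : R[i] :=
  Complex (Rintegral mu setT (@complex.Re R \o f))
          (Rintegral mu setT (@complex.Im R \o f)).

Definition inner f g : R[i] := Cintegral (fun x => f x * conjc (g x)).

(* S stands for the set of classes of its members, so orthogonality is asked of
   members that differ as elements of L^2(mu), not merely as functions. *)
Definition orthonormal S :=
  [/\ S `<=` L2,
      forall f, S f -> inner f f = 1
    & forall f g, S f -> S g -> ~ (f = g %[ae mu]) -> inner f g = 0].

(* The finite linear combinations of members of S are dense in L^2(mu). *)
Definition dense_span S :=
  forall f, L2 f -> forall eps : R, 0 < eps ->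
    exists n (c : 'I_n -> R[i]) (s : 'I_n -> T -> R[i]),
      (forall i, S (s i)) /\
      (L2norm (fun x => f x - \sum_(i < n) c i * s i x)%R < eps%:E)%E.

Definition orthonormal_basis S := orthonormal S /\ dense_span S.

End ComplexL2.

Section PlusSpace.
Variable R : realType.

Definition mu01 : set (measurableTypeR R) -> \bar R :=
  mrestr lebesgue_measure (@measurable_itv R `[0%R, 1%R]).
HB.instance Definition _ := Measure.on mu01.

Lemma mu01_fin_num_fun : fin_num_fun mu01.
Proof.
apply: lty_fin_num_fun; rewrite /= /mu01 /mrestr setIC setIT.
by rewrite lebesgue_measure_itv /= lte_fin ltr01 oppr0 adde0 ltry.
Qed.
HB.instance Definition _ := Measure_isFinite.Build _ _ _ mu01 mu01_fin_num_fun.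

Definition delta0 : set (measurableTypeR R) -> \bar R :=
  @dirac _ (measurableTypeR R) 0 R.
HB.instance Definition _ := FiniteMeasure.on delta0.

Definition rho : set (measurableTypeR R * measurableTypeR R) -> \bar R :=
  mscale (2^-1)%:nng (measure_add (mu01 \x delta0)%E (delta0 \x mu01)%E).
HB.instance Definition _ := Measure.on rho.

Definition expi (t : R) : R[i] := Complex (cos t) (sin t).

Definition echar (l : R * R) (z : R * R) : R[i] :=
  expi (2 * pi * (l.1 * z.1 + l.2 * z.2)).

Definition E (L : set (R * R)) : set (R * R -> R[i]) := [set echar l | l in L].

End PlusSpace.

Arguments mu01 R : clear implicits.
Arguments delta0 R : clear implicits.
Arguments rho R : clear implicits.

(* Main.v *)
Require Import Defs.
From HB Require Import structures.
From mathcomp Require Import all_boot all_order all_algebra.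
From mathcomp Require Import complex.
From mathcomp Require Import all_classical all_reals all_analysis.
From mathcomp Require Import measurable_realfun.
From mathcomp Require Import ring lra.
Import Order.TTheory GRing.Theory Num.Theory.
Import numFieldNormedType.Exports.
Local Open Scope classical_set_scope.
Local Open Scope ring_scope.
Set Implicit Arguments.
Unset Strict Implicit.
Unset Printing Implicit Defensive.

(** Write e(a,b) for the character with frequency (a,b).  Multiplicatively
    e(a,b) times the conjugate of e(a',b') is e(a-a',b-b'), so orthogonality of
    a family of characters is a condition on the differences of frequencies:
    f(a) + f(b) = 0, where f is the Fourier transform of Lebesgue measure on
    [0,1].

    Solving f(a) + f(b) = 0 with elementary trigonometry
    ([orthogonal_frequencies]) leaves two cases: a and b are both nonzero
    integers, or b = -a with 2a an integer.  Let L be a spectrum containing the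
    origin.  Its frequencies cannot all be integers: the function equal to 1 on
    one segment and to -1 on the other would be orthogonal to every character
    ([exists_noninteger]).  So some l0 in L is a noninteger (k/2,-k/2).  For an
    integer pair l in L, the difference l - l0 is not an integer pair, hence it
    is antidiagonal, and so is l.  Therefore L is contained in the antidiagonal
    set D of all (n/2,-n/2).  The characters with frequencies in D are
    orthonormal, so one of them missing from L would be a unit vector orthogonal
    to a total family ([not_dense_span_orthogonal]); hence L = D.

    It remains to see that the characters of D are total.  Mapping (x,y) to x - y
    unfolds the two segments to [-1,1]; there the characters of D become the
    exponentials of period 2, and rho becomes a finite measure carried by ]-1,1[
    ([antidiagonal_dense]).  Totality of these exponentials
    ([exponentials_dense]) holds for every finite measure carried by ]-1,1[.  If g
    is a real trigonometric polynomial, explicit polynomials in g converge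
    boundedly to the indicator of the set where g > 0
    ([approximable_positivity_set]); every ray meets ]-1,1[ in such a set
    ([ray_trigonometric]); and the indicators of all Borel sets, then all square
    integrable functions, follow by the pi-lambda theorem and dominated
    convergence ([approximable_measurable_set], [dense_span_of_indic]). *)

(** * Square norms of complex functions *)

Section SquaredNorm.
Variable R : realType.
Implicit Types (z w : R[i]) (x : R).

Definition sqn z : R := complex.Re z ^+ 2 + complex.Im z ^+ 2.

Lemma sqn_ge0 z : 0 <= sqn z.
Proof. by rewrite addr_ge0 ?sqr_ge0. Qed.

Lemma sqn0 : sqn 0 = 0.
Proof. by rewrite /sqn /= expr0n addr0. Qed.

Lemma sqn_real x : sqn x%:C%C = x ^+ 2.
Proof. by rewrite /sqn /= expr0n addr0. Qed.

Lemma sqnM z w : sqn (z * w) = sqn z * sqn w.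
Proof. by case: z w => [a b] [c d]; rewrite /sqn /=; ring. Qed.

(** The parallelogram inequality makes the square norm usable in place of the
    norm: it is subadditive up to the factor 2. *)
Lemma sqnD_le z w : sqn (z + w) <= 2 * sqn z + 2 * sqn w.
Proof.
case: z w => [a b] [c d]; rewrite /sqn /= -subr_ge0.
rewrite (_ : _ - _ = (a - c) ^+ 2 + (b - d) ^+ 2); last by ring.
by rewrite addr_ge0 ?sqr_ge0.
Qed.

Lemma normc_sqn z : ComplexField.Normc.normc z = Num.sqrt (sqn z).
Proof. by case: z. Qed.

Lemma Re_sqr_le z : complex.Re z ^+ 2 <= sqn z.
Proof. by rewrite lerDl sqr_ge0. Qed.

Lemma Im_sqr_le z : complex.Im z ^+ 2 <= sqn z.
Proof. by rewrite lerDr sqr_ge0. Qed.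

Lemma normr_Re_le1 z : sqn z = 1 -> `|complex.Re z| <= 1.
Proof.
move=> z1; have := Re_sqr_le z; rewrite z1 => r1.
by rewrite ler_norml; apply/andP; split; nra.
Qed.

Lemma normr_Im_le1 z : sqn z = 1 -> `|complex.Im z| <= 1.
Proof.
move=> z1; have := Im_sqr_le z; rewrite z1 => r1.
by rewrite ler_norml; apply/andP; split; nra.
Qed.

End SquaredNorm.

Section Energy.
Context d (T : measurableType d) (R : realType).
Variable mu : {measure set T -> \bar R}.
Implicit Types f g : T -> R[i].

(** Squares of L^2 norms; working with them avoids roots of extended reals, and
    [L2norm_lt] translates back. *)
Definition energy f : \bar R := (\int[mu]_x (sqn (f x))%:E)%E.

Lemma energy_ge0 f : (0 <= energy f)%E.
Proof. by apply: integral_ge0 => x _; rewrite lee_fin sqn_ge0. Qed.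

Lemma L2normE f : L2norm mu f = (energy f `^ 2^-1)%E.
Proof.
rewrite /L2norm unlock; congr (_ `^ _)%E.
apply: eq_integral => x _; rewrite normc_sqn /=; congr (_%:E).
rewrite ger0_norm ?sqrtr_ge0//.
by rewrite powR_mulrn ?sqrtr_ge0// sqr_sqrtr ?sqn_ge0.
Qed.

Lemma L2norm_lt f (eps : R) : 0 < eps ->
  (L2norm mu f < eps%:E)%E = (energy f < (eps ^+ 2)%:E)%E.
Proof.
move=> e0; rewrite L2normE.
have -> : eps%:E = ((eps ^+ 2)%:E `^ 2^-1)%E.
  by rewrite poweR12_sqrt ?lee_fin ?sqr_ge0//= sqrtr_sqr gtr0_norm.
rewrite !poweR12_sqrt ?energy_ge0 ?lee_fin ?sqr_ge0//.
have := energy_ge0 f; case: (energy f) => [r| |]//=.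
rewrite lee_fin !lte_fin => r0.
by rewrite ltr_sqrt// exprn_gt0.
Qed.

Lemma L2norm_fin f : (L2norm mu f < +oo)%E = (energy f < +oo)%E.
Proof.
rewrite L2normE; apply/idP/idP; last exact: poweR_lty.
by apply: lty_poweRy; rewrite invr_eq0.
Qed.

Lemma cmeasurable_sqn f : cmeasurable f -> measurable_fun setT (fun x => sqn (f x)).
Proof.
by case=> mr mi; apply: measurable_funD; exact: measurable_funX.
Qed.

Lemma cmeasurableD f g : cmeasurable f -> cmeasurable g ->
  cmeasurable (fun x => f x + g x).
Proof.
move=> [fr fi] [gr gi]; split.
  rewrite [X in measurable_fun _ X](_ : _ =
    (@complex.Re R \o f) \+ (@complex.Re R \o g)); first exact: measurable_funD.
  by apply/funext => x /=; case: (f x) (g x) => [? ?] [? ?].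
rewrite [X in measurable_fun _ X](_ : _ =
  (@complex.Im R \o f) \+ (@complex.Im R \o g)); first exact: measurable_funD.
by apply/funext => x /=; case: (f x) (g x) => [? ?] [? ?].
Qed.

Lemma cmeasurableM f g : cmeasurable f -> cmeasurable g ->
  cmeasurable (fun x => f x * g x).
Proof.
move=> [fr fi] [gr gi]; split.
  rewrite [X in measurable_fun _ X](_ : _ =
    ((@complex.Re R \o f) \* (@complex.Re R \o g)) \-
    ((@complex.Im R \o f) \* (@complex.Im R \o g))).
    by apply: measurable_funB; exact: measurable_funM.
  by apply/funext => x /=; case: (f x) (g x) => [? ?] [? ?].
rewrite [X in measurable_fun _ X](_ : _ =
  ((@complex.Re R \o f) \* (@complex.Im R \o g)) \+
  ((@complex.Im R \o f) \* (@complex.Re R \o g))).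
  by apply: measurable_funD; exact: measurable_funM.
by apply/funext => x /=; case: (f x) (g x) => [? ?] [? ?].
Qed.

Lemma cmeasurable_cst (c : R[i]) : cmeasurable (fun _ : T => c).
Proof. by split; exact: measurable_cst. Qed.

Lemma cmeasurableB f g : cmeasurable f -> cmeasurable g ->
  cmeasurable (fun x => f x - g x).
Proof.
move=> mf mg; apply: cmeasurableD => //.
have -> : (fun x => - g x) = (fun x => (-1) * g x).
  by apply/funext => x; rewrite mulN1r.
exact: (cmeasurableM (cmeasurable_cst _) mg).
Qed.

Lemma cmeasurable_real (u : T -> R) : measurable_fun setT u ->
  cmeasurable (fun x => (u x)%:C%C).
Proof. by move=> mu_; split => //; exact: measurable_cst. Qed.

Lemma energyD_le f g : cmeasurable f -> cmeasurable g ->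
  (energy (fun x => f x + g x)%R <= 2%:E * energy f + 2%:E * energy g)%E.
Proof.
move=> mf mg.
have mfs := cmeasurable_sqn mf; have mgs := cmeasurable_sqn mg.
rewrite /energy -!ge0_integralZl//; last 4 first.
- by apply/measurable_EFinP.
- by move=> x _; rewrite lee_fin sqn_ge0.
- by apply/measurable_EFinP.
- by move=> x _; rewrite lee_fin sqn_ge0.
rewrite -ge0_integralD//; last 4 first.
- by move=> x _; rewrite mule_ge0// lee_fin ?sqn_ge0.
- by apply/measurable_EFinP; exact: measurable_funM.
- by move=> x _; rewrite mule_ge0// lee_fin ?sqn_ge0.
- by apply/measurable_EFinP; exact: measurable_funM.
apply: ge0_le_integral => //.
- by move=> x _; rewrite lee_fin sqn_ge0.
- by apply/measurable_EFinP; apply/cmeasurable_sqn/cmeasurableD.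
- apply/measurable_EFinP; apply: measurable_funD; exact: measurable_funM.
- by move=> x _; rewrite -!EFinM -EFinD lee_fin sqnD_le.
Qed.

Lemma energyZ (c : R[i]) f : cmeasurable f ->
  (energy (fun x => c * f x)%R = (sqn c)%:E * energy f)%E.
Proof.
move=> mf; rewrite /energy -ge0_integralZl//.
- by apply: eq_integral => x _; rewrite sqnM EFinM.
- by apply/measurable_EFinP; exact: cmeasurable_sqn.
- by move=> x _; rewrite lee_fin sqn_ge0.
- by rewrite lee_fin sqn_ge0.
Qed.

End Energy.

(** * Finite linear combinations *)

Section Span.
Context d (T : measurableType d) (R : realType).
Implicit Types (S : set (T -> R[i])) (p q s : T -> R[i]) (c : R[i]).

Definition span S : set (T -> R[i]) := [set p |
  exists n (c : 'I_n -> R[i]) (s : 'I_n -> T -> R[i]),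
    (forall i, S (s i)) /\ p = fun x => \sum_(i < n) c i * s i x].

Lemma span0 S : span S (fun=> 0).
Proof.
exists 0%N, (fun=> 0), (fun=> fun=> 0); split; first by case.
by apply/funext => x; rewrite big_ord0.
Qed.

Lemma span_cons S c s p : S s -> span S p -> span S (fun x => c * s x + p x).
Proof.
move=> Ss [n [c' [s' [Ss' ->]]]].
exists n.+1, (fun i => if unlift ord0 i is Some j then c' j else c),
  (fun i => if unlift ord0 i is Some j then s' j else s); split.
  by move=> i; case: unliftP => // j _; exact: Ss'.
apply/funext => x; rewrite big_ord_recl unlift_none; congr (_ + _).
by apply: eq_bigr => i _; rewrite liftK.
Qed.

(** Peeling off one term at a time replaces the bookkeeping of finite index
    types in all closure properties below. *)
Lemma span_ind S (P : (T -> R[i]) -> Prop) :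
  P (fun=> 0) ->
  (forall c s p, S s -> span S p -> P p -> P (fun x => c * s x + p x)) ->
  forall p, span S p -> P p.
Proof.
move=> P0 PS p [n]; elim: n p => [|n IH] p [c [s [Ss ->]]].
  suff -> : (fun x => \sum_(i < 0) c i * s i x) = (fun=> 0) by [].
  by apply/funext => x; rewrite big_ord0.
pose p' x := \sum_(i < n) c (lift ord0 i) * s (lift ord0 i) x.
have sp' : exists (c0 : 'I_n -> R[i]) (s0 : 'I_n -> T -> R[i]),
    (forall i, S (s0 i)) /\ p' = fun x => \sum_(i < n) c0 i * s0 i x.
  by exists (fun i => c (lift ord0 i)), (fun i => s (lift ord0 i)).
have -> : (fun x => \sum_(i < n.+1) c i * s i x) =
    (fun x => c ord0 * s ord0 x + p' x).
  by apply/funext => x; rewrite big_ord_recl.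
by apply: PS; [exact: Ss|exists n|exact: IH].
Qed.

Lemma spanD S p q : span S p -> span S q -> span S (fun x => p x + q x).
Proof.
move=> Sp Sq; move: p Sp; apply: span_ind.
  by under eq_fun do rewrite add0r.
move=> c s p Ss _ IH.
rewrite (_ : (fun x => _) = (fun x => c * s x + (p x + q x))).
  exact: span_cons.
by apply/funext => x; rewrite addrA.
Qed.

Lemma spanZ S c p : span S p -> span S (fun x => c * p x).
Proof.
move: p; apply: span_ind.
  by under eq_fun do rewrite mulr0; exact: span0.
move=> c' s p Ss _ IH.
rewrite (_ : (fun x => _) = (fun x => (c * c') * s x + c * p x)).
  exact: span_cons.
by apply/funext => x; rewrite mulrDr mulrA.
Qed.

Lemma sub_span S : S `<=` span S.
Proof.
move=> s Ss; have := span_cons 1 Ss (span0 S).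
by under eq_fun do rewrite mul1r addr0.
Qed.

Lemma spanM S p q :
  (forall s t, S s -> S t -> S (fun x => s x * t x)) ->
  span S p -> span S q -> span S (fun x => p x * q x).
Proof.
move=> SM Sp Sq; move: p Sp; apply: span_ind.
  by under eq_fun do rewrite mul0r; exact: span0.
move=> c s p Ss _ IH.
rewrite (_ : (fun x => _) = (fun x => c * (s x * q x) + p x * q x)); last first.
  by apply/funext => x; rewrite mulrDl mulrA.
apply: spanD => //; apply: spanZ; move: q Sq {IH}; apply: span_ind.
  by under eq_fun do rewrite mulr0; exact: span0.
move=> c' s' q Ss' _ IH.
rewrite (_ : (fun x => _) = (fun x => c' * (s x * s' x) + s x * q x)).
  by apply: span_cons => //; exact: SM.
by apply/funext => x; rewrite mulrDr mulrCA.
Qed.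

Lemma spanX S p n : S (fun=> 1) ->
  (forall s t, S s -> S t -> S (fun x => s x * t x)) ->
  span S p -> span S (fun x => p x ^+ n).
Proof.
move=> S1 SM Sp; elim: n => [|n IH]; first exact: sub_span.
by under eq_fun do rewrite exprS; exact: spanM.
Qed.

Lemma span_cmeasurable S : S `<=` @cmeasurable d T R ->
  span S `<=` @cmeasurable d T R.
Proof.
move=> mS; apply: span_ind; first exact: cmeasurable_cst.
move=> c s p Ss _ mp; apply: cmeasurableD => //.
by apply: cmeasurableM; [exact: cmeasurable_cst|exact: mS].
Qed.

End Span.

(** * The closed span *)

Section Approximable.
Context d (T : measurableType d) (R : realType).
Variable mu : {measure set T -> \bar R}.
Variable S : set (T -> R[i]).
Hypothesis mS : S `<=` @cmeasurable d T R.
Implicit Types (f g : T -> R[i]) (u v : T -> R).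

(** The L^2 closure of the span of S. *)
Definition approximable f := forall eps : R, 0 < eps ->
  exists p, span S p /\ (energy mu (fun x => f x - p x)%R < eps%:E)%E.

Lemma span_approximable : span S `<=` approximable.
Proof.
move=> p Sp eps e0; exists p; split => //.
rewrite /energy; under eq_integral do rewrite subrr sqn0.
by rewrite integral0 lte_fin.
Qed.

Lemma approximable_close f : cmeasurable f ->
  (forall eps : R, 0 < eps -> exists g, [/\ cmeasurable g, approximable g &
     (energy mu (fun x => f x - g x)%R < eps%:E)%E]) ->
  approximable f.
Proof.
move=> mf fg eps e0.
have e4 : 0 < eps / 4 by lra.
have [g [mg ag fge]] := fg _ e4.
have [p [Sp gpe]] := ag _ e4; exists p; split => //.
have mp := span_cmeasurable mS Sp.
rewrite (_ : (fun x => _) = (fun x => (f x - g x) + (g x - p x))); last first.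
  by apply/funext => x; rewrite subrKA.
apply: (le_lt_trans (energyD_le mu (cmeasurableB mf mg) (cmeasurableB mg mp))).
have -> : eps%:E = (2%:E * (eps / 4)%:E + 2%:E * (eps / 4)%:E)%E.
  by rewrite -!EFinM -EFinD; congr (_%:E); lra.
by apply: lteD; rewrite lte_pmul2l.
Qed.

Lemma approximableD f g : cmeasurable f -> cmeasurable g ->
  approximable f -> approximable g -> approximable (fun x => f x + g x).
Proof.
move=> mf mg af ag eps e0.
have e4 : 0 < eps / 4 by lra.
have [p [Sp fpe]] := af _ e4; have [q [Sq gqe]] := ag _ e4.
exists (fun x => p x + q x); split; first exact: spanD.
have mp := span_cmeasurable mS Sp; have mq := span_cmeasurable mS Sq.
rewrite (_ : (fun x => _) = (fun x => (f x - p x) + (g x - q x))); last first.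
  by apply/funext => x; rewrite addrACA opprD.
apply: (le_lt_trans (energyD_le mu (cmeasurableB mf mp) (cmeasurableB mg mq))).
have -> : eps%:E = (2%:E * (eps / 4)%:E + 2%:E * (eps / 4)%:E)%E.
  by rewrite -!EFinM -EFinD; congr (_%:E); lra.
by apply: lteD; rewrite lte_pmul2l.
Qed.

Lemma approximableZ c f : cmeasurable f ->
  approximable f -> approximable (fun x => c * f x).
Proof.
move=> mf af eps e0.
have c0 : 0 < sqn c + 1 by rewrite ltr_wpDl ?sqn_ge0.
have [p [Sp fpe]] := af _ (divr_gt0 e0 c0).
exists (fun x => c * p x); split; first exact: spanZ.
have mp := span_cmeasurable mS Sp.
rewrite (_ : (fun x => _) = (fun x => c * (f x - p x))); last first.
  by apply/funext => x; rewrite mulrBr.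
rewrite energyZ; last exact: cmeasurableB.
apply: (@le_lt_trans _ _ ((sqn c + 1)%:E * energy mu (fun x => f x - p x)%R)%E).
  by apply: lee_wpmul2r; [exact: energy_ge0|rewrite lee_fin lerDl].
by rewrite muleC -lte_pdivlMr.
Qed.

Lemma approximableB f g : cmeasurable f -> cmeasurable g ->
  approximable f -> approximable g -> approximable (fun x => f x - g x).
Proof.
move=> mf mg af ag.
rewrite (_ : (fun x => _) = (fun x => f x + (-1) * g x)); last first.
  by apply/funext => x; rewrite mulN1r.
apply: approximableD => //; last exact: approximableZ.
by apply: cmeasurableM => //; exact: cmeasurable_cst.
Qed.

(** Under an L^2 bound on the error, dominated convergence sends the energy of
    the error to 0.  Almost everywhere convergence of a constant sequence also
    covers changes on null sets. *)
Lemma approximable_dominated (u_ : (T -> R)^nat) u v :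
  (forall n, measurable_fun setT (u_ n)) -> measurable_fun setT u ->
  (forall n, approximable (fun x => (u_ n x)%:C%C)) ->
  {ae mu, forall x, u_ ^~ x @ \oo --> u x} ->
  (forall n x, `|u x - u_ n x| <= v x) ->
  mu.-integrable setT (fun x => (v x ^+ 2)%:E) ->
  approximable (fun x => (u x)%:C%C).
Proof.
move=> mu_ mu0 au_ cu_ uv iv.
apply: approximable_close; first exact: cmeasurable_real.
move=> eps e0.
have [| | | | |_ _] := @dominated_convergence _ _ _ mu _ measurableT
  (fun n x => ((u x - u_ n x) ^+ 2)%:E) (cst 0%E) (fun x => (v x ^+ 2)%:E).
- move=> n; apply/measurable_EFinP; apply: measurable_funX.
  exact: measurable_funB.
- exact: measurable_cst.
- apply: filterS cu_ => x cx _.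
  have ud0 : (u x - u_ n x) @[n --> \oo] --> 0.
    by rewrite -(subrr (u x)); apply: cvgB => //; exact: cvg_cst.
  apply/cvg_EFin; first exact: nearW.
  by rewrite -(mulr0 0); exact: (cvgM ud0 ud0).
- exact: iv.
- apply: aeW => x n _; rewrite /= lee_fin ger0_norm ?sqr_ge0//.
  by rewrite -real_normK ?num_real// lerXn2r// nnegrE (le_trans _ (uv n x)).
rewrite integral0 => /fine_cvgP[fin /cvgrPdist_lt /(_ _ e0) small].
have [N _ /(_ N (leqnn N)) [/= finN]] := filterI fin small.
rewrite sub0r normrN ger0_norm; last first.
  by apply: fine_ge0; apply: integral_ge0 => x _; rewrite lee_fin sqr_ge0.
move=> smallN; exists (fun x => (u_ N x)%:C%C); split.
- exact: cmeasurable_real.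
- exact: au_.
rewrite /energy; under eq_integral do rewrite -rmorphB sqn_real.
by rewrite -(fineK finN) lte_fin.
Qed.

End Approximable.

(** * Polynomials approximating a step *)

Section ThresholdPolynomials.
Variable R : realType.
Implicit Types (w z : R).

Lemma one_add_mulr_le_exp z n : 0 <= z -> 1 + n%:R * z <= (1 + z) ^+ n.
Proof.
move=> z0; elim: n => [|n IH]; first by rewrite mul0r addr0 expr0.
rewrite exprS; apply: (@le_trans _ _ ((1 + z) * (1 + n%:R * z))); last first.
  by rewrite ler_wpM2l// addr_ge0.
have : 0 <= n%:R * z * z by rewrite !mulr_ge0.
rewrite -natr1; nra.
Qed.

Lemma one_sub_mulr_le_exp z n : 0 <= z <= 1 -> 1 - n%:R * z <= (1 - z) ^+ n.
Proof.
move=> /andP[z0 z1]; elim: n => [|n IH]; first by rewrite mul0r subr0 expr0.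
rewrite exprS; apply: (@le_trans _ _ ((1 - z) * (1 - n%:R * z))); last first.
  by rewrite ler_wpM2l// subr_ge0.
have : 0 <= n%:R * z * z by rewrite !mulr_ge0.
rewrite -natr1; nra.
Qed.

(** Split z ^ n as y ^ n * y ^ n with y = sqrt z: the Bernoulli inequality for
    1 / y bounds n * y ^ n, and the other factor tends to 0. *)
Lemma cvg_natr_mul_exp z : 0 <= z < 1 -> n%:R * z ^+ n @[n --> \oo] --> 0.
Proof.
move=> /andP[z0 z1].
have [->|zn0] := eqVneq z 0.
  rewrite (_ : (fun n => _) = cst 0); first exact: cvg_cst.
  by apply/funext => -[|n] /=; rewrite ?mul0r// expr0n mulr0.
pose y := Num.sqrt z.
have y0 : 0 < y by rewrite sqrtr_gt0 lt_neqAle eq_sym zn0.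
have y1 : y < 1 by rewrite -(@sqrtr1 R) ltr_sqrt.
have y2 : z = y * y by rewrite -expr2 sqr_sqrtr.
pose h := y^-1 - 1.
have h0 : 0 < h by rewrite subr_gt0 invf_gt1.
have yh : y^-1 = 1 + h by rewrite /h addrC subrK.
apply: (@squeeze_cvgr _ _ _ _ (cst 0) (geometric h^-1 y)).
- near=> n; rewrite mulr_ge0 ?exprn_ge0//= y2 exprMn mulrA ler_pM2r ?exprn_gt0//.
  have yn0 : 0 < y ^+ n by exact: exprn_gt0.
  have : (1 + n%:R * h) * y ^+ n <= 1.
    rewrite -ler_pdivlMr// mul1r -exprVn yh.
    by apply: one_add_mulr_le_exp; exact: ltW.
  move=> le1; suff : h * (n%:R * y ^+ n) <= 1 by rewrite -ler_pdivlMl// mulr1.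
  lra.
- exact: cvg_cst.
- by apply: cvg_geometric; rewrite gtr0_norm.
Unshelve. all: by end_near. Qed.

(** Polynomials in w that tend on [0, 1] to the indicator of w < 1/2.  With
    N = n * 2 ^ n the quantity N * w ^ n is n * (2 * w) ^ n; the extra factor n
    makes it unbounded also at w = 1/2, so the limit at the jump is 0. *)
Definition threshold n w := (1 - w ^+ n) ^+ (n * 2 ^ n).

Lemma threshold_itv n w : 0 <= w <= 1 -> 0 <= threshold n w <= 1.
Proof.
move=> /andP[w0 w1].
have /andP[wn0 wn1] : 0 <= w ^+ n <= 1 by rewrite exprn_ge0// exprn_ile1.
by rewrite exprn_ge0 ?exprn_ile1//; lra.
Qed.

(** By Bernoulli, (1 - w ^ n) ^ N lies above 1 - N * w ^ n and below
    1 / (1 + N * w ^ n). *)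
Lemma cvg_threshold w : 0 <= w <= 1 ->
  threshold n w @[n --> \oo] --> ((w < 1 / 2)%R%:R : R).
Proof.
move=> w01; have /andP[w0 w1] := w01.
have wn01 n : 0 <= w ^+ n <= 1 by rewrite exprn_ge0// exprn_ile1.
have NE n : (n * 2 ^ n)%:R * w ^+ n = n%:R * (2 * w) ^+ n.
  by rewrite natrM natrX -mulrA exprMn.
case: ltP => w2.
  apply: (@squeeze_cvgr _ _ _ _ (fun n => 1 - n%:R * (2 * w) ^+ n) (cst 1)).
  - near=> n; have /andP[_ ->] := threshold_itv n w01.
    by rewrite -NE one_sub_mulr_le_exp.
  - rewrite -[X in _ --> X]subr0; apply: cvgB; first exact: cvg_cst.
    by apply: cvg_natr_mul_exp; lra.
  - exact: cvg_cst.
apply: (@squeeze_cvgr _ _ _ _ (cst 0) (@harmonic R)).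
- near=> n; have /andP[-> _] := threshold_itv n w01.
  have n1 : 1 + n%:R <= (1 + w ^+ n) ^+ (n * 2 ^ n).
    apply: (le_trans _ (one_add_mulr_le_exp _ _)); last by have /andP[] := wn01 n.
    rewrite lerD2l NE ler_peMr//; apply: exprn_ege1; lra.
  rewrite /= -[leRHS]mul1r ler_pdivlMr// -nat1r.
  apply: (@le_trans _ _ (threshold n w * (1 + w ^+ n) ^+ (n * 2 ^ n))).
    by rewrite ler_wpM2l//; have /andP[] := threshold_itv n w01.
  rewrite /threshold -exprMn exprn_ile1//; have := wn01 n; nra.
- exact: cvg_cst.
- exact: cvg_harmonic.
Unshelve. all: by end_near. Qed.

End ThresholdPolynomials.

Section PositivitySet.
Context d (T : measurableType d) (R : realType).
Variable mu : {measure set T -> \bar R}.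
Hypothesis mufin : (mu setT < +oo)%E.
Variable S : set (T -> R[i]).
Hypothesis mS : S `<=` @cmeasurable d T R.

Lemma integrable_sqr_cst (k : R) : mu.-integrable setT (fun=> (k ^+ 2)%:E).
Proof.
apply/integrableP; split; first exact: measurable_cst.
rewrite integral_cst//= lte_mul_pinfty//.
Qed.

(** When S is closed under products, polynomials in g stay in the span, so
    threshold polynomials evaluated at an affine image of g approximate the
    indicator; they are bounded by 1, which a finite measure integrates. *)
Lemma approximable_positivity_set (g : T -> R) (M : R) :
  S (fun=> 1) -> (forall s t, S s -> S t -> S (fun x => s x * t x)) ->
  measurable_fun setT g -> span S (fun x => (g x)%:C%C) ->
  (forall x, `|g x| <= M) ->
  approximable mu S (fun x => (\1_[set x | 0 < g x] x)%:C%C).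
Proof.
move=> S1 SM mg Sg gM.
wlog M0 : M gM / 0 < M.
  move=> /(_ (`|M| + 1)); apply; last by rewrite ltr_wpDl.
  by move=> x; rewrite (le_trans (gM x))// ler_wpDr// ler_norm.
(* w maps [-M, M] to [0, 1] so that g > 0 exactly when w < 1/2 *)
pose w x := 1 / 2 - (2 * M)^-1 * g x.
have w01 x : 0 <= w x <= 1.
  have : `|(2 * M)^-1 * g x| <= 1 / 2.
    rewrite normrM gtr0_norm ?invr_gt0 ?mulr_gt0//.
    by rewrite ler_pdivrMl ?mulr_gt0//; have := gM x; lra.
  by rewrite ler_norml /w; lra.
have wE x : (w x < 1 / 2) = (0 < g x).
  by rewrite /w ltrBlDr ltrDl pmulr_rgt0// invr_gt0 mulr_gt0.
have mw : measurable_fun setT w.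
  apply: measurable_funB; first exact: measurable_cst.
  by apply: measurable_funM => //; exact: measurable_cst.
have Sw : span S (fun x => (w x)%:C%C).
  rewrite (_ : (fun x => _) = (fun x =>
      (1 / 2)%:C%C * 1 + (- (2 * M)^-1)%:C%C * (g x)%:C%C)).
    apply: spanD; first by apply: spanZ; exact: sub_span.
    exact: spanZ.
  by apply/funext => x; rewrite -!rmorphM -rmorphD /= mulr1 mulNr.
apply: (@approximable_dominated _ _ _ _ _ mS
  (fun n x => threshold n (w x)) _ (cst 1)).
- move=> n; apply: measurable_funX.
  by apply: measurable_funB; [exact: measurable_cst|exact: measurable_funX].
- apply: measurable_indic; rewrite (_ : [set x | _] = setT `&` g @^-1` `]0, +oo[).
    exact: mg.
  by apply/seteqP; split => x /=; rewrite in_itv /= andbT; [split|case].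
- move=> n; apply: span_approximable.
  rewrite (_ : (fun x => _) = (fun x =>
      (1 + (-1) * (w x)%:C%C ^+ n) ^+ (n * 2 ^ n))).
    apply: spanX => //; apply: spanD; first exact: sub_span.
    by apply: spanZ; exact: spanX.
  by apply/funext => x; rewrite rmorphXn /= rmorphB /= rmorph1 rmorphXn /= mulN1r.
- apply: aeW => x; have := cvg_threshold (w01 x).
  rewrite wE indicE; have -> // : (x \in [set x | 0 < g x]) = (0 < g x).
  by apply/idP/idP; rewrite inE.
- move=> n x; have /andP[t0 t1] := threshold_itv n (w01 x).
  by rewrite indicE; case: (_ \in _); rewrite /= ler_norml; apply/andP; split; lra.
- exact: integrable_sqr_cst.
Qed.

End PositivitySet.

(** * From generating sets to the whole space *)

Section Density.
Context d (T : measurableType d) (R : realType).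
Variable mu : {measure set T -> \bar R}.
Hypothesis mufin : (mu setT < +oo)%E.
Variable S : set (T -> R[i]).
Hypothesis mS : S `<=` @cmeasurable d T R.

Let indicC (A : set T) x : R[i] := (\1_A x)%:C%C.

Let cmeasurable_indicC A : measurable A -> cmeasurable (indicC A).
Proof. by move=> mA; apply: cmeasurable_real; exact: measurable_indic. Qed.

(** The sets with approximable indicator form a lambda-system: proper
    differences by linearity, increasing unions by dominated convergence. *)
Lemma approximable_measurable_set (G : set (set T)) :
  @measurable d T = <<s G >> -> setI_closed G ->
  approximable mu S (fun=> 1) ->
  (forall A, G A -> approximable mu S (indicC A)) ->
  forall A, measurable A -> approximable mu S (indicC A).
Proof.
move=> GE GI a1 aG.
pose H := [set A : set T | measurable A /\ approximable mu S (indicC A)].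
suff GH : <<s G >> `<=` H by move=> A; rewrite GE => /GH[].
apply: lambda_system_subset => //; last first.
  by move=> A GA; split; [rewrite GE; exact: sub_sigma_algebra|exact: aG].
split => //.
- split => //; rewrite /indicC (_ : (fun x => _) = (fun=> 1)) //.
  by apply/funext => x; rewrite indicT.
- move=> A B BA [mA aA] [mB aB]; split; first exact: measurableD.
  rewrite (_ : indicC _ = (fun x => indicC A x - indicC B x)).
    by apply: approximableB => //; exact: cmeasurable_indicC.
  apply/funext => x; rewrite /indicC -rmorphB; congr (_%:C)%C.
  rewrite !indicE in_setD; have [xB|xB] := boolP (x \in B); last first.
    by rewrite andbT subr0.
  by rewrite andbF (mem_set (BA _ (set_mem xB))) subrr.
- move=> F ndF HF; have mF n : measurable (F n) by have [] := HF n.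
  have mU : measurable (\bigcup_n F n) by exact: bigcupT_measurable.
  split => //; apply: (@approximable_dominated _ _ _ _ _ mS
    (fun n => \1_(F n)) _ (cst 1)).
  + by move=> n; exact: measurable_indic.
  + exact: measurable_indic.
  + by move=> n; have [] := HF n.
  + apply: aeW => x; have [[N _ FNx]|nF] := pselect ((\bigcup_n F n) x).
      apply: (@cvg_trans _ ((1 : R) @[n --> \oo])).
        apply: near_eq_cvg; near=> n; rewrite indicE mem_set//.
        have Nn : (N <= n)%N by near: n; exact: nbhs_infty_ge.
        by move/subsetPset : (ndF _ _ Nn); apply.
      by rewrite indicE mem_set; [exact: cvg_cst|exists N].
    rewrite (_ : (fun n => _) = cst 0).
      by rewrite indicE memNset//; exact: cvg_cst.
    by apply/funext => n; rewrite indicE memNset// => Fnx; apply: nF; exists n.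
  + move=> n x; rewrite !indicE.
    by do 2 case: (_ \in _); rewrite /= ler_norml; apply/andP; split; lra.
  + exact: integrable_sqr_cst.
Unshelve. all: by end_near. Qed.

Hypothesis approximable_indic :
  forall A, measurable A -> approximable mu S (indicC A).

Import HBNNSimple.

Lemma approximable_nnsfun (h : {nnsfun T >-> R}) :
  approximable mu S (fun x => (h x)%:C%C).
Proof.
rewrite (_ : (fun x => _) = (fun x =>
   \sum_(y <- finmap.enum_fset (fset_set (range h)))
   y%:C%C * indicC (h @^-1` [set y]) x)); last first.
  apply/funext => x; rewrite fimfunE fsbig_finite//= rmorph_sum /=.
  by apply: eq_bigr => y _; rewrite rmorphM.
elim: (finmap.enum_fset _) => [|y s IH].
  under eq_fun do rewrite big_nil.
  exact/span_approximable/span0.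
have mhy : cmeasurable (indicC (h @^-1` [set y])) by exact: cmeasurable_indicC.
under eq_fun do rewrite big_cons.
apply: approximableD => //.
- by apply: cmeasurableM => //; exact: cmeasurable_cst.
- elim: s {IH} => [|z s IH].
    by under eq_fun do rewrite big_nil; exact: cmeasurable_cst.
  under eq_fun do rewrite big_cons.
  apply: cmeasurableD => //; apply: cmeasurableM; first exact: cmeasurable_cst.
  exact: cmeasurable_indicC.
- by apply: approximableZ => //; exact: approximable_indic.
Qed.

Lemma approximable_nonneg (u : T -> R) : measurable_fun setT u ->
  (forall x, 0 <= u x) -> mu.-integrable setT (fun x => (u x ^+ 2)%:E) ->
  approximable mu S (fun x => (u x)%:C%C).
Proof.
move=> mu_ u0 iu.
have meu : measurable_fun setT (EFin \o u) by exact/measurable_EFinP.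
have eu0 x : setT x -> (0 <= (EFin \o u) x)%E by move=> _; rewrite lee_fin.
pose h := nnsfun_approx measurableT meu.
apply: (@approximable_dominated _ _ _ _ _ mS (fun n x => h n x) _ u) => //.
- by move=> n; exact: approximable_nnsfun.
- apply: aeW => x.
  exact: fine_cvg (cvg_nnsfun_approx measurableT meu eu0 (I : setT x)).
- move=> n x; rewrite ger0_norm ?subr_ge0; last first.
    have := le_approx n eu0 (I : setT x).
    by rewrite lee_fin /h nnsfun_approxE.
  by rewrite lerBlDr lerDl.
Qed.

Lemma approximable_real (u : T -> R) : measurable_fun setT u ->
  mu.-integrable setT (fun x => (u x ^+ 2)%:E) ->
  approximable mu S (fun x => (u x)%:C%C).
Proof.
move=> mu_ iu.
have part (v : T -> R) : measurable_fun setT v -> (forall x, `|v x| = `|u x|) ->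
    measurable_fun setT (fun x => Num.max (v x) 0) /\
    approximable mu S (fun x => (Num.max (v x) 0)%:C%C).
  move=> mv vu.
  have mm : measurable_fun setT (fun x => Num.max (v x) 0).
    by apply: measurable_maxr => //; exact: measurable_cst.
  split=> //; apply: approximable_nonneg => //.
    by move=> x; rewrite le_max lexx orbT.
  apply: le_integrable iu => //.
    by apply/measurable_EFinP; exact: measurable_funX.
  move=> x _; rewrite /= lee_fin !normrX -(vu x) lerXn2r ?nnegrE//.
  by rewrite /Num.max; case: ltP => // _; rewrite normr0.
have [m1 a1] := part u mu_ (fun=> erefl).
have [m2 a2] := part (fun x => - u x)
  (measurableT_comp (@oppr_measurable R setT) mu_) (fun x => normrN (u x)).
rewrite (_ : (fun x => _) =
    (fun x => (Num.max (u x) 0)%:C%C - (Num.max (- u x) 0)%:C%C)).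
  by apply: approximableB => //; exact: cmeasurable_real.
apply/funext => x; rewrite -rmorphB; congr (_%:C)%C.
by rewrite /Num.max; case: (ltP (u x)) => ?; case: ltP => ?; lra.
Qed.

(** Simple functions are combinations of indicators, nonnegative functions are
    limits of simple functions below them, and the rest is linearity. *)
Theorem dense_span_of_indic : dense_span mu S.
Proof.
move=> f [mf]; rewrite L2norm_fin => fin eps e0.
have [mr mi] := mf.
have intg (u : T -> R) : measurable_fun setT u ->
    (forall x, u x ^+ 2 <= sqn (f x)) ->
    mu.-integrable setT (fun x => (u x ^+ 2)%:E).
  move=> mu_ uf; apply/integrableP; split.
    by apply/measurable_EFinP; exact: measurable_funX.
  apply: le_lt_trans fin; apply: ge0_le_integral => //.
  - apply/measurable_EFinP; apply: measurableT_comp => //.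
    exact: measurable_funX.
  - by apply/measurable_EFinP; exact: cmeasurable_sqn.
  - by move=> x _; rewrite /= lee_fin ger0_norm ?sqr_ge0.
have af : approximable mu S f.
  rewrite (_ : f = (fun x =>
      (complex.Re (f x))%:C%C + 'i%C * (complex.Im (f x))%:C%C)).
    have ar := approximable_real mr (intg _ mr (fun x => Re_sqr_le (f x))).
    have ai := approximable_real mi (intg _ mi (fun x => Im_sqr_le (f x))).
    have cr := cmeasurable_real mr; have ci := cmeasurable_real mi.
    apply: approximableD => //.
      by apply: cmeasurableM => //; exact: cmeasurable_cst.
    exact: approximableZ.
  by apply/funext => x; exact: complexE.
have [p [[n [c [s [Ss ->]]]] fp]] := af _ (exprn_gt0 2 e0).
by exists n, c, s; split => //; rewrite L2norm_lt.
Qed.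

End Density.

(** * Exponentials of period 2 *)

Section Exponentials.
Variable R : realType.
Implicit Types (s t c : R) (n : int).

Lemma expi0 : expi 0 = 1 :> R[i].
Proof. by rewrite /expi cos0 sin0. Qed.

Lemma expiD s t : expi (s + t) = expi s * expi t.
Proof. by rewrite /expi cosD sinD; congr Complex; ring. Qed.

Lemma expiN t : expi (- t) = conjc (expi t).
Proof. by rewrite /expi cosN sinN. Qed.

Lemma sqn_expi t : sqn (expi t) = 1.
Proof. exact: cos2Dsin2. Qed.

Lemma cos_expi s t :
  (cos (t - s))%:C%C = (expi (- s) / 2) * expi t + (expi s / 2) * expi (- t).
Proof.
have i2 : (2 : R[i])^-1 = (2^-1)%:C%C by rewrite fmorphV rmorph_nat.
rewrite i2 /expi cosB !cosN !sinN.
by apply/eqP; rewrite eq_complex /=; apply/andP; split; apply/eqP; field.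
Qed.

Definition expZ n t : R[i] := expi (pi * n%:~R * t).

Definition exponentials : set (R -> R[i]) := [set expZ n | n in [set: int]].

Lemma expZ0 : expZ 0 = fun=> 1.
Proof. by apply/funext => t; rewrite /expZ mulr0 mul0r expi0. Qed.

Lemma exponentials1 : exponentials (fun=> 1).
Proof. by exists 0 => //; rewrite expZ0. Qed.

Lemma exponentialsM p q : exponentials p -> exponentials q ->
  exponentials (fun t => p t * q t).
Proof.
move=> [m _ <-] [n _ <-]; exists (m + n) => //; apply/funext => t.
by rewrite /expZ -expiD intrD mulrDr mulrDl.
Qed.

Lemma cmeasurable_expi d (T : measurableType d) (u : T -> R) :
  measurable_fun setT u -> cmeasurable (fun x => expi (u x)).
Proof.
move=> mu; split; apply: (measurableT_comp _ mu).
  by apply: continuous_measurable_fun; exact: continuous_cos.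
by apply: continuous_measurable_fun; exact: continuous_sin.
Qed.

Lemma cmeasurable_exponentials :
  exponentials `<=` @cmeasurable _ (measurableTypeR R) R.
Proof.
move=> _ [n _ <-]; apply: cmeasurable_expi.
exact: measurable_funM.
Qed.

(** On ]-1, 1[ the ray beyond c, for -1 <= c < 1, is the arc from c to 1 of a circle of length 2,
    so it is cut out by one inequality cos (pi (t - m)) > cos (pi r) with m the
    midpoint and r the half-length of the arc.  As a product, the difference of
    the cosines is 2 sin (pi (t - c) / 2) sin (pi (1 - t) / 2), whose second
    factor is positive. *)
Lemma ray_trigonometric c : exists g : R -> R,
  [/\ measurable_fun setT (g : measurableTypeR R -> measurableTypeR R),
      span exponentials (fun t => (g t)%:C%C), (forall t, `|g t| <= 2)
    & forall t, -1 < t < 1 -> (c < t) = (0 < g t)].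
Proof.
have cst_span k : span exponentials (fun=> k).
  rewrite (_ : (fun=> k) = (fun=> k * 1)); last by rewrite mulr1.
  apply: spanZ.
  exact/sub_span/exponentials1.
have [c1|c1] := ltP c (-1).
  exists (fun=> 1); split; [exact: measurable_cst|exact: cst_span| |].
  - by move=> t; rewrite normr1; lra.
  - by move=> t t11; rewrite ltr01; move/andP: t11 => [t1 _]; lra.
have [c2|c2] := leP 1 c.
  exists (fun=> 0); split; [exact: measurable_cst|exact: cst_span| |].
  - by move=> t; rewrite normr0.
  - move=> t /andP[_ t1]; rewrite ltxx; apply/negbTE; rewrite -leNgt.
    lra.
pose A t := pi * (t - c) / 2; pose B t := pi * (1 - t) / 2.
pose k := cos (pi * (1 - c) / 2).
exists (fun t => cos (pi * t - pi * (1 + c) / 2) - k); split.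
- apply: measurable_funB; last exact: measurable_cst.
  apply: (@measurableT_comp _ _ _ _ _ _ cos).
    by apply: continuous_measurable_fun; exact: continuous_cos.
  by apply: measurable_funB; [exact: measurable_funM|exact: measurable_cst].
- set s := pi * (1 + c) / 2.
  rewrite (_ : (fun t => _) = (fun t => ((expi (- s) / 2) * expZ 1 t +
    (expi s / 2) * expZ (-1) t) + (- k)%:C%C)).
    apply: spanD; last exact: cst_span.
    apply: spanD; apply: spanZ; apply: sub_span; first by exists 1.
    by exists (-1).
  apply/funext => t; rewrite rmorphB /= cos_expi rmorphN; congr (_ + _).
  by rewrite /expZ mulr1 mulrN1 mulNr.
- move=> t; have := cos_max (pi * t - pi * (1 + c) / 2).
  by have := cos_max (pi * (1 - c) / 2); rewrite -/k !ler_norml; lra.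
move=> t t11.
have -> : cos (pi * t - pi * (1 + c) / 2) - k = 2 * (sin (A t) * sin (B t)).
  have -> : pi * t - pi * (1 + c) / 2 = A t - B t by rewrite /A /B; field.
  have -> : k = cos (A t + B t) by congr cos; rewrite /A /B; field.
  by rewrite cosB cosD; ring.
have pi0 : 0 < pi :> R := pi_gt0 R.
have sB : 0 < sin (B t) by apply: sin_gt0_pi; rewrite /B; nra.
rewrite pmulr_rgt0// pmulr_lgt0//.
have [tc|tc|ct] := ltgtP c t.
- by apply/esym; apply: sin_gt0_pi; rewrite /A; nra.
- apply/esym/negbTE; rewrite -leNgt -oppr_ge0 -sinN; apply/ltW/sin_gt0_pi.
  by rewrite /A; nra.
- by rewrite /A ct subrr mulr0 mul0r sin0 ltxx.
Qed.

(** The period of the exponentials is the length of ]-1, 1[, so a ray meets it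
    in an arc of the circle, whose indicator is approximable; and rays form a
    pi-system that generates the Borel sets. *)
Theorem exponentials_dense (nu : {measure set (measurableTypeR R) -> \bar R}) :
  (nu setT < +oo)%E -> nu (~` `]-1, 1[) = 0 -> dense_span nu exponentials.
Proof.
move=> nufin nu0; apply: dense_span_of_indic => //.
  exact: cmeasurable_exponentials.
apply: (approximable_measurable_set nufin cmeasurable_exponentials
  (G := @RGenOInfty.G R)).
- exact: RGenOInfty.measurableE.
- move=> _ _ [x ->] [y ->]; exists (Num.max x y); apply/seteqP; split => z /=.
    by rewrite !in_itv /= !andbT => -[xz yz]; rewrite gt_max xz.
  by rewrite !in_itv /= !andbT gt_max => /andP[].
- exact/span_approximable/sub_span/exponentials1.
move=> _ [c ->].
have [g [mg Sg g2 cg]] := ray_trigonometric c.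
have mpos : measurable ([set t | 0 < g t] : set (measurableTypeR R)).
  rewrite (_ : [set t | _] = setT `&` g @^-1` `]0, +oo[).
    by apply: mg => //; exact: measurable_itv.
  by apply/seteqP; split => x /=; rewrite in_itv /= andbT; [split|case].
apply: (@approximable_dominated _ _ _ nu _ cmeasurable_exponentials
  (fun=> \1_[set t | 0 < g t]) (\1_(`]c, +oo[%classic)) (cst 1)).
- by move=> _; exact: measurable_indic.
- by apply: measurable_indic; exact: measurable_itv.
- by move=> _; exact: (approximable_positivity_set nufin
    cmeasurable_exponentials exponentials1 exponentialsM mg Sg g2).
- exists (~` `]-1, 1[); split => //; first exact: measurableC.
  move=> t; apply: contra_not => /=; rewrite in_itv /= => t11.
  suff -> : \1_(`]c, +oo[%classic) t = \1_[set t | 0 < g t] t :> R.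
    exact: cvg_cst.
  rewrite !indicE; congr ((nat_of_bool _)%:R); apply/idP/idP;
    rewrite !inE /= in_itv /= andbT -(cg _ t11)//.
- move=> n t; rewrite !indicE.
  by do 2 case: (_ \in _); rewrite /= ler_norml; apply/andP; split; lra.
- exact: integrable_sqr_cst.
Qed.

End Exponentials.

(** * The measure on the two segments *)

Section PlusIntegrals.
Variable R : realType.
Local Notation RR := (measurableTypeR R).

Lemma mu01E (A : set RR) : mu01 R A = lebesgue_measure (A `&` `[0, 1]).
Proof. by []. Qed.

Lemma ge0_integral_mu01 (f : RR -> \bar R) : measurable_fun setT f ->
  (forall x, 0 <= f x)%E ->
  (\int[mu01 R]_x f x = \int[lebesgue_measure]_(x in `[0%R, 1%R]) f x)%E.
Proof.
move=> mf f0.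
pose I : set RR := `[0, 1]%classic.
have mI : measurable I by exact: measurable_itv.
rewrite (@ge0_negligible_integral _ _ _ _ setT (~` I)) //; last 2 first.
- exact: measurableC.
- by rewrite [LHS]mu01E setICl measure0.
rewrite setTD setCK; apply: eq_measure_integral => A mA /setIidl A01.
by rewrite [LHS]mu01E A01.
Qed.

Lemma ge0_integral_rho (F : RR * RR -> \bar R) : measurable_fun setT F ->
  (forall z, 0 <= F z)%E ->
  (\int[rho R]_z F z = 2^-1%:E *
    (\int[mu01 R]_x F (x, 0%R) + \int[mu01 R]_y F (0%R, y)))%E.
Proof.
move=> mF F0; rewrite /rho ge0_integral_mscale//=.
congr (_ * _)%E.
rewrite ge0_integral_measure_add//; congr (_ + _)%E.
  rewrite fubini_tonelli1//; apply: eq_integral => x _.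
  rewrite /fubini_F integral_dirac//.
    by rewrite diracT mul1e.
  exact: measurableT_comp.
rewrite fubini_tonelli1// integral_dirac//.
  by rewrite diracT mul1e.
exact: measurable_fun_fubini_tonelli_F.
Qed.

Lemma mu01T : mu01 R setT = 1%E.
Proof.
by rewrite mu01E setTI lebesgue_measure_itv /= lte_fin ltr01 oppr0 adde0.
Qed.

Lemma rhoT : rho R setT = 1%E.
Proof.
rewrite -[LHS]mul1e -(integral_cst (rho R) measurableT).
rewrite ge0_integral_rho//= integral_cst// mul1e.
transitivity ((2^-1 : R)%:E * (1 + 1))%E.
  by congr (_ * (_ + _))%E; exact: mu01T.
by rewrite -EFinD -EFinM; congr (_%:E); lra.
Qed.

(** On the horizontal segment this is x and on the vertical one it is - y, so
    the two segments are laid out on [0, 1] and [-1, 0]; [fold_plus] undoes it. *)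
Definition unfold_plus (z : RR * RR) : RR := z.1 - z.2.
Definition fold_plus (t : RR) : RR * RR := (Num.max t 0, Num.max (- t) 0).

Lemma measurable_unfold_plus : measurable_fun setT unfold_plus.
Proof. by apply: measurable_funB. Qed.

Lemma measurable_fold_plus : measurable_fun setT fold_plus.
Proof.
apply: measurable_fun_pair; apply: measurable_maxr => //; exact: oppr_measurable.
Qed.

HB.instance Definition _ :=
  isMeasurableFun.Build _ _ _ _ unfold_plus measurable_unfold_plus.

(** Half of Lebesgue measure on [-1, 1]. *)
Definition rho_line : set RR -> \bar R := pushforward (rho R) unfold_plus.

Let rho_line0 : rho_line set0 = 0%E.
Proof. exact: measure0. Qed.

Let rho_line_ge0 A : (0 <= rho_line A)%E.
Proof. exact: measure_ge0. Qed.

Let rho_line_sigma_additive : semi_sigma_additive rho_line.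
Proof. exact: measure_semi_sigma_additive. Qed.

HB.instance Definition _ := isMeasure.Build _ _ _ rho_line
  rho_line0 rho_line_ge0 rho_line_sigma_additive.

Lemma rho_lineT : rho_line setT = 1%E.
Proof. exact: rhoT. Qed.

(** The complement of ]-1, 1[ is symmetric and meets [0, 1] in the point 1. *)
Lemma rho_line_itv : rho_line (~` `]-1, 1[) = 0%E.
Proof.
pose N : set RR := ~` `]-1, 1[%classic.
have mN : measurable N by apply: measurableC; exact: measurable_itv.
have mtN : measurable (unfold_plus @^-1` N).
  by rewrite -[X in measurable X]setTI; exact: measurable_unfold_plus.
rewrite /rho_line /pushforward -/N.
rewrite -[X in rho R X]setIT -integral_indic// ge0_integral_rho//; last first.
  by apply/measurable_EFinP; exact: measurable_indic.
have N0 (x : RR) : (\1_(unfold_plus @^-1` N) (x, 0) : R) = \1_N x.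
  by rewrite !indicE /unfold_plus; congr ((nat_of_bool _)%:R);
    apply/idP/idP; rewrite !inE /= subr0.
have N0' (y : RR) : (\1_(unfold_plus @^-1` N) (0, y) : R) = \1_N y.
  rewrite !indicE /unfold_plus; congr ((nat_of_bool _)%:R).
  by apply/idP/idP; rewrite !inE /N /= sub0r !in_itv /= => h xN; apply: h;
    apply/andP; move/andP : xN => [? ?]; split; lra.
under eq_integral do rewrite N0.
under [X in (_ + X)%E]eq_integral do rewrite N0'.
rewrite integral_indic// setIT.
suff N00 : mu01 R N = 0%E.
  transitivity ((2^-1 : R)%:E * (0 + 0))%E; last by rewrite adde0 mule0.
  by congr (_ * (_ + _))%E.
rewrite [LHS]mu01E; apply/eqP; rewrite -measure_le0.
rewrite -(lebesgue_measure_set1 (1 : R)); apply: le_measure; rewrite ?inE//.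
  by apply: measurableI => //; exact: measurable_itv.
move=> x [] /=; rewrite /N /= !in_itv /= => xN /andP[x0 x1].
apply/eqP; rewrite eq_le x1 leNgt /=; apply/negP => x1'.
by apply: xN; rewrite x1' andbT; lra.
Qed.

End PlusIntegrals.
Arguments rho_line R : clear implicits.

(** * Totality of the antidiagonal characters *)

Section PlusUnfolding.
Variable R : realType.
Local Notation RR := (measurableTypeR R).

Lemma fold_plusK : cancel (@fold_plus R) (@unfold_plus R).
Proof.
by move=> t; rewrite /unfold_plus /fold_plus /= /Num.max; do 2 case: ltP => ?; lra.
Qed.

(** Folding undoes unfolding on the two segments, which carry rho. *)
Lemma ge0_integral_unfold (F : RR * RR -> \bar R) :
  measurable_fun setT F -> (forall z, 0 <= F z)%E ->
  (\int[rho R]_z F z = \int[rho_line R]_t F (fold_plus t))%E.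
Proof.
move=> mF F0.
have mFf : measurable_fun setT (F \o @fold_plus R).
  by apply: measurableT_comp => //; exact: measurable_fold_plus.
have mFfu : measurable_fun setT (F \o @fold_plus R \o @unfold_plus R).
  by apply: measurableT_comp => //; exact: measurable_unfold_plus.
rewrite [RHS](ge0_integral_pushforward (@measurable_unfold_plus R))//.
rewrite preimage_setT !ge0_integral_rho//; last by move=> z; exact: F0.
have mx (G : RR * RR -> \bar R) : measurable_fun setT G ->
    measurable_fun setT (fun x : RR => G (x, 0)).
  by move=> mG; apply: measurableT_comp => //; exact: pair2_measurable.
have my (G : RR * RR -> \bar R) : measurable_fun setT G ->
    measurable_fun setT (fun y : RR => G (0, y)).
  by move=> mG; apply: measurableT_comp => //; exact: pair1_measurable.
have eq01 (f g : RR -> \bar R) : measurable_fun setT f -> measurable_fun setT g ->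
    (forall t, 0 <= f t)%E -> (forall t, 0 <= g t)%E ->
    (forall t, 0 <= t <= 1 -> f t = g t) ->
    (\int[mu01 R]_t f t = \int[mu01 R]_t g t)%E.
  move=> mf mg f0 g0 fg; rewrite !ge0_integral_mu01//.
  by apply: eq_integral => t; rewrite inE /= in_itv /= => /fg.
congr (_ * (_ + _))%E; apply: eq01 => //=;
  [exact: (mx _ mF)|exact: (mx _ mFfu)| |
   exact: (my _ mF)|exact: (my _ mFfu)|] => t /andP[t0 _].
  rewrite /unfold_plus /fold_plus /= subr0.
  by rewrite max_l// max_r// oppr_le0.
rewrite /unfold_plus /fold_plus /= sub0r opprK.
by rewrite (max_l t0) max_r// oppr_le0.
Qed.

Lemma energy_unfold (f : RR * RR -> R[i]) : cmeasurable f ->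
  energy (rho R) f = energy (rho_line R) (f \o @fold_plus R).
Proof.
move=> mf; rewrite /energy ge0_integral_unfold//.
  by apply/measurable_EFinP; exact: cmeasurable_sqn.
by move=> z; rewrite lee_fin sqn_ge0.
Qed.

Lemma dense_span_unfold (S : set (RR -> R[i])) :
  S `<=` @cmeasurable _ RR R -> dense_span (rho_line R) S ->
  dense_span (rho R) [set s \o @unfold_plus R | s in S].
Proof.
move=> mS dS f [mf ff] eps e0.
have mff : cmeasurable (f \o @fold_plus R).
  by case: mf => fr fi; split;
    [apply: (measurableT_comp fr)|apply: (measurableT_comp fi)];
    exact: measurable_fold_plus.
have [|n [c [s [Ss fs]]]] := dS (f \o @fold_plus R) _ eps e0.
  by split => //; rewrite L2norm_fin -energy_unfold// -L2norm_fin.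
exists n, c, (fun i => s i \o @unfold_plus R); split.
  by move=> i; exists (s i).
move: fs; rewrite !L2norm_lt// energy_unfold.
  congr (_ < _)%E; apply: eq_integral => t _ /=; congr (sqn (_ - _))%:E.
  by apply: eq_bigr => i _; rewrite fold_plusK.
apply: cmeasurableB => //.
suff : span [set s \o @unfold_plus R | s in S] `<=` @cmeasurable _ _ R.
  apply; exists n, c, (fun i => s i \o @unfold_plus R); split => // i.
  by exists (s i).
apply: span_cmeasurable => _ [t /mS[tr ti] <-].
by split; [apply: (measurableT_comp tr)|apply: (measurableT_comp ti)];
  exact: measurable_unfold_plus.
Qed.

Definition antidiagonal : set (R * R) :=
  [set (n%:~R / 2, - (n%:~R / 2)) | n in [set: int]].

(** The phase 2 pi (n/2 x - n/2 y) is pi n (x - y). *)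
Lemma E_antidiagonal :
  E antidiagonal = [set s \o @unfold_plus R | s in @exponentials R].
Proof.
have eE n : echar (n%:~R / 2, - (n%:~R / 2)) = @expZ R n \o @unfold_plus R.
  by apply/funext => z; rewrite /echar /expZ /unfold_plus /=; congr expi; field.
apply/seteqP; split => [_ [_ [n _ <-] <-]|_ [_ [n _ <-] <-]].
  by exists (expZ n); [exists n|rewrite eE].
by exists (n%:~R / 2, - (n%:~R / 2)); [exists n|rewrite eE].
Qed.

Lemma antidiagonal_dense : dense_span (rho R) (E antidiagonal).
Proof.
rewrite E_antidiagonal; apply: dense_span_unfold.
  exact: cmeasurable_exponentials.
apply: exponentials_dense; last exact: rho_line_itv.
by apply: (@le_lt_trans _ _ 1%E); [rewrite -(rho_lineT R)|rewrite ltry].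
Qed.

End PlusUnfolding.

(** * Integrals of bounded functions and of sines *)

Section RealIntegrals.
Variable R : realType.
Local Notation RR := (measurableTypeR R).

Lemma bounded_integrable d (T : measurableType d)
    (mu : {measure set T -> \bar R}) (f : T -> R) (M : R) :
  (mu setT < +oo)%E -> measurable_fun setT f -> (forall x, `|f x| <= M) ->
  mu.-integrable setT (EFin \o f).
Proof.
move=> mufin mf fM; apply/integrableP; split; first exact/measurable_EFinP.
apply: (@le_lt_trans _ _ (\int[mu]_x (cst M%:E x))%E).
  apply: ge0_le_integral => //.
  - by apply/measurable_EFinP; exact: measurableT_comp.
  - by move=> x _; rewrite lee_fin.
by rewrite integral_cst// lte_mul_pinfty// lee_fin (le_trans _ (fM point)).
Qed.

Lemma rho_fin : (rho R setT < +oo)%E.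
Proof. by apply: (@le_lt_trans _ _ 1%E); [rewrite -(rhoT R)|rewrite ltry]. Qed.

Lemma Rintegral_rho (F : RR * RR -> R) (M : R) :
  measurable_fun setT F -> (forall z, `|F z| <= M) ->
  (\int[rho R]_z F z = (\int[lebesgue_measure]_(x in `[0, 1]) F (x, 0) +
    \int[lebesgue_measure]_(y in `[0, 1]) F (0, y)) / 2)%R.
Proof.
move=> mF FM.
have M0 : 0 <= M := le_trans (normr_ge0 _) (FM point).
have m01 : measurable (`[0, 1]%classic : set RR) by exact: measurable_itv.
have leb01E : lebesgue_measure (`[0%R, 1%R]%classic : set R) = 1%E.
  by rewrite lebesgue_measure_itv /= lte_fin ltr01 oppr0 adde0.
have leb01 : (lebesgue_measure (`[0%R, 1%R]%classic : set RR) < +oo)%E.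
  by apply: (@le_lt_trans _ _ 1%E); [rewrite -leb01E|rewrite ltry].
have mx : measurable_fun setT (fun x : RR => F (x, 0)).
  by apply: measurableT_comp => //; exact: pair2_measurable.
have my : measurable_fun setT (fun y : RR => F (0, y)).
  by apply: measurableT_comp => //; exact: pair1_measurable.
have int01 (h : RR -> R) (K : R) : measurable_fun setT h ->
    (forall x, `|h x| <= K) ->
    lebesgue_measure.-integrable (`[0, 1]%classic : set RR) (EFin \o h).
  move=> mh hM; apply: measurable_bounded_integrable => //.
    exact: measurable_funS mh.
  exists K; split; first exact: num_real.
  by move=> N KN x _ /=; exact: le_trans (hM x) (ltW KN).
have cst01 :
    lebesgue_measure.-integrable (`[0, 1]%classic : set RR) (EFin \o cst M).
  by apply: (int01 _ M) => // x; rewrite ger0_norm.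
have leb1 : (\int[lebesgue_measure]_(x in (`[0, 1]%classic : set RR)) M)%R = M.
  rewrite Rintegral_cst//; transitivity (M * fine (1%E : \bar R)).
    by congr (_ * fine _); exact: leb01E.
  by rewrite mulr1.
have cstrho : (rho R).-integrable setT (EFin \o cst M).
  by apply: (bounded_integrable rho_fin (M := M)) => // x; rewrite ger0_norm.
have Frho : (rho R).-integrable setT (EFin \o F).
  exact: (bounded_integrable rho_fin mF FM).
(* the formula for nonnegative integrands is applied to F + M *)
have FM0 z : 0 <= F z + M by have := FM z; rewrite ler_norml; lra.
have : (\int[rho R]_z (F z + M) =
    (\int[lebesgue_measure]_(x in `[0, 1]) (F (x, 0) + M) +
    \int[lebesgue_measure]_(y in `[0, 1]) (F (0, y) + M)) / 2)%R.
  rewrite /Rintegral ge0_integral_rho; last 2 first.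
  - by apply/measurable_EFinP; apply: measurable_funD.
  - by move=> z; rewrite lee_fin.
  rewrite !ge0_integral_mu01; last 4 first.
  - by apply/measurable_EFinP; apply: measurable_funD.
  - by move=> z; rewrite lee_fin.
  - by apply/measurable_EFinP; apply: measurable_funD.
  - by move=> z; rewrite lee_fin.
  have fx : (\int[lebesgue_measure]_(x in `[0%R, 1%R]) (F (x, 0) + M)%:E)%E
      \is a fin_num.
    apply: integrable_fin_num => //; apply: (int01 (fun x => F (x, 0) + M) (M + M)).
      exact: measurable_funD.
    by move=> x; have := FM (x, 0); rewrite !ler_norml; lra.
  have fy : (\int[lebesgue_measure]_(x in `[0%R, 1%R]) (F (0, x) + M)%:E)%E
      \is a fin_num.
    apply: integrable_fin_num => //; apply: (int01 (fun y => F (0, y) + M) (M + M)).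
      exact: measurable_funD.
    by move=> y; have := FM (0, y); rewrite !ler_norml; lra.
  rewrite fineM//; last by rewrite fin_numD; apply/andP.
  by rewrite fineD// mulrC.
have rho1 : (\int[rho R]_z M)%R = M.
  rewrite Rintegral_cst//; transitivity (M * fine (1%E : \bar R)).
    by congr (_ * fine _); exact: rhoT.
  by rewrite mulr1.
rewrite RintegralD// rho1 !RintegralD//; try exact: (int01 _ M).
rewrite leb1 => rhoE; apply: (addIr M); rewrite rhoE; by field.
Qed.

Lemma is_derive_scale (k x : R) : is_derive x 1 (fun y : R => k * y) k.
Proof. by apply: is_derive_eq; exact: mulr1. Qed.

Lemma is_derive_sin_scale (k x : R) :
  is_derive x 1 (fun y => sin (k * y)) (k * cos (k * x)).
Proof.
rewrite mulrC.
exact: (is_derive1_comp (is_derive_sin (k * x)) (is_derive_scale k x)).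
Qed.

Lemma is_derive_cos_scale (k x : R) :
  is_derive x 1 (fun y => cos (k * y)) (- (k * sin (k * x))).
Proof.
rewrite mulrC -mulNr.
exact: (is_derive1_comp (is_derive_cos (k * x)) (is_derive_scale k x)).
Qed.

Lemma Rintegral01_derive (f F : R -> R) :
  (forall x : R, is_derive x 1 F (f x)) -> continuous f ->
  (\int[lebesgue_measure]_(x in `[0, 1]) f x)%R = F 1 - F 0.
Proof.
move=> dF cf.
have cF : continuous F.
  move=> x; apply: differentiable_continuous; apply/derivable1_diffP.
  exact: (@ex_derive _ _ _ _ _ _ _ (dF x)).
rewrite /Rintegral (@continuous_FTC2 _ f F)//.
- exact: continuous_subspaceT.
- split.
  + by move=> x _; exact: (@ex_derive _ _ _ _ _ _ _ (dF x)).
  + by apply: cvg_at_right_filter; exact: cF.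
  + by apply: cvg_at_left_filter; exact: cF.
- by move=> x _; rewrite derive1E; exact: (@derive_val _ _ _ _ _ _ _ (dF x)).
Qed.

Lemma continuous_scale (g : R -> R) (k : R) : continuous g ->
  continuous (fun x => g (k * x)).
Proof.
move=> cg x; apply: (@continuous_comp _ _ _ (fun y => k * y) g); last exact: cg.
exact: mulrl_continuous.
Qed.

Lemma integrable01_continuous (f : R -> R) : continuous f ->
  lebesgue_measure.-integrable `[0, 1] (EFin \o f).
Proof.
move=> cf; apply: continuous_compact_integrable; first exact: segment_compact.
exact: continuous_subspaceT.
Qed.

(** Keeping the factor k on the left makes the formula true for k = 0 too. *)
Lemma Rintegral01_cos (k : R) :
  k * (\int[lebesgue_measure]_(x in `[0, 1]) cos (k * x))%R = sin k.
Proof.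
have ck := continuous_scale (k := k) (@continuous_cos R).
rewrite -RintegralZl//; last exact: integrable01_continuous.
rewrite (Rintegral01_derive (is_derive_sin_scale k)).
  by rewrite mulr1 mulr0 sin0 subr0.
by move=> x; apply: cvgM; [exact: cvg_cst|exact: ck].
Qed.

Lemma Rintegral01_sin (k : R) :
  k * (\int[lebesgue_measure]_(x in `[0, 1]) sin (k * x))%R = 1 - cos k.
Proof.
have cs := continuous_scale (k := k) (@continuous_sin R).
have d (x : R) : is_derive x 1 (fun y => - cos (k * y)) (k * sin (k * x)).
  have := is_derive_cos_scale k x => dc.
  by rewrite -[X in is_derive _ _ _ X]opprK; exact: is_deriveN.
rewrite -RintegralZl//; last exact: integrable01_continuous.
rewrite (Rintegral01_derive d).
  by rewrite mulr1 mulr0 cos0 opprK addrC.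
by move=> x; apply: cvgM; [exact: cvg_cst|exact: cs].
Qed.

End RealIntegrals.

(** * Orthogonality to the constants *)

Section PlusFourier.
Variable R : realType.
Local Notation RR := (measurableTypeR R).
Implicit Types a b : R.

(** With [sinI], the real and imaginary parts of the Fourier transform of
    Lebesgue measure on [0, 1]. *)
Definition cosI a : R :=
  (\int[lebesgue_measure]_(x in `[0, 1]) cos (2 * pi * a * x))%R.
Definition sinI a : R :=
  (\int[lebesgue_measure]_(x in `[0, 1]) sin (2 * pi * a * x))%R.

Lemma cosIE a : (2 * pi * a) * cosI a = sin (2 * pi * a).
Proof. exact: Rintegral01_cos. Qed.

Lemma sinIE a : (2 * pi * a) * sinI a = 1 - cos (2 * pi * a).
Proof. exact: Rintegral01_sin. Qed.

Lemma cosI0 : cosI 0 = 1.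
Proof.
rewrite /cosI; under eq_Rintegral do rewrite mulr0 mul0r cos0.
rewrite Rintegral_cst// mul1r; transitivity (fine (1%E : \bar R)) => //.
congr fine; transitivity (lebesgue_measure (`[0%R, 1%R]%classic : set R)) => //.
by rewrite lebesgue_measure_itv /= lte_fin ltr01 oppr0 adde0.
Qed.

Lemma sinI0 : sinI 0 = 0.
Proof.
rewrite /sinI; under eq_Rintegral do rewrite mulr0 mul0r sin0.
by rewrite Rintegral_cst// mul0r.
Qed.

Lemma twopi_neq0 a : a != 0 -> 2 * pi * a != 0.
Proof. by move=> a0; rewrite !mulf_neq0// ?gt_eqF ?pi_gt0. Qed.

Lemma sinIN a : sinI (- a) = - sinI a.
Proof.
have [->|a0] := eqVneq a 0; first by rewrite oppr0 sinI0 oppr0.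
apply: (mulfI (twopi_neq0 a0)); rewrite mulrN sinIE -[in RHS](cosN (2 * pi * a)).
by rewrite -mulrN -sinIE; ring.
Qed.

Lemma sin_lt (x : R) : 0 < x -> sin x < x.
Proof.
move=> x0; have [x1|x1] := ltP 1 x; first by rewrite (le_lt_trans (sin_le1 x)).
have [c] := @MVT R sin cos 0 x x0 (fun y _ => is_derive_sin y)
  (continuous_subspaceT (@continuous_sin R)).
rewrite in_itv /= sin0 !subr0 => /andP[c0 cx] ->.
rewrite -[ltRHS]mul1r ltr_pM2r// lt_neqAle cos_le1 andbT -(@cos0 R).
apply/eqP => c1; have := pi_ge2 R => p2.
suff : c = 0 by lra.
by apply: cos_inj c1; rewrite in_itv /=; lra.
Qed.

(** Distinguishes the frequency 0, and hence characters that agree almost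
    everywhere. *)
Lemma cosI_lt1 a : a != 0 -> cosI a < 1.
Proof.
move=> a0; have k0 := twopi_neq0 a0; set k := 2 * pi * a in k0 *.
have := cosIE a; rewrite -/k => kE.
have [kp|kn] := ltP 0 k.
  by rewrite -(ltr_pM2l kp) kE mulr1 sin_lt.
have kn' : 0 < - k by rewrite oppr_gt0 lt_neqAle k0.
rewrite -(ltr_pM2l kn') mulNr kE mulr1 -sinN sin_lt//.
Qed.

Lemma sin_mulz_pi (n : int) : sin (n%:~R * pi) = 0 :> R.
Proof.
have h (m : nat) : sin (m%:R * pi) = 0 :> R.
  elim: m => [|m IH]; first by rewrite mul0r sin0.
  by rewrite -natr1 mulrDl mul1r sinDpi IH oppr0.
case: n => m; first exact: h.
by rewrite NegzE mulrNz mulNr sinN h oppr0.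
Qed.

Lemma sin_eq0P (x : R) : sin x = 0 -> exists n : int, x = n%:~R * pi.
Proof.
move=> sx; have p0 : 0 < pi :> R := pi_gt0 R.
exists (Num.floor (x / pi)); set n := Num.floor _.
have /andP[n1 n2] := floor_itv (x / pi); rewrite -/n in n1 n2.
have y0 : 0 <= x - n%:~R * pi by rewrite subr_ge0 -ler_pdivlMr.
have y1 : x - n%:~R * pi < pi.
  by rewrite ltrBlDr -[X in X + _]mul1r -mulrDl -ltr_pdivrMr// addrC -intrD1.
have sy : sin (x - n%:~R * pi) = 0 by rewrite sinB sx sin_mulz_pi mul0r mulr0 subr0.
apply/eqP; rewrite -subr_eq0 eq_le y0 andbT leNgt; apply/negP => y0'.
by have := @sin_gt0_pi R (x - n%:~R * pi); rewrite y0' y1 sy ltxx => /(_ isT).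
Qed.

Lemma cos_eq1P a : cos (2 * pi * a) = 1 -> exists n : int, a = n%:~R.
Proof.
move=> c1; have : sin (pi * a) = 0.
  have : cos (2 * pi * a) = 1 - 2 * sin (pi * a) ^+ 2.
    have -> : 2 * pi * a = pi * a + pi * a by ring.
    by rewrite cosD -!expr2 cos2sin2; ring.
  rewrite c1 => s2; apply/eqP; rewrite -sqrf_eq0; apply/eqP; lra.
move=> /sin_eq0P[n nE]; exists n.
by apply: (mulIf (lt0r_neq0 (pi_gt0 R))); rewrite -nE mulrC.
Qed.

(** With k = 2 pi a and l = 2 pi b, and C, S the values of cosI and sinI at a,
    sine and cosine of k are k C and 1 - k S, and those of l are - l C and
    1 + l S.  The Pythagorean identities give (k + l) (C ^ 2 + S ^ 2) = 0.  If
    C = S = 0, both cosines are 1 and a, b are integers; if l = - k, oddness of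
    the sine forces C = 0, so sin k = 0 and 2 a is an integer. *)
Lemma orthogonal_frequencies a b : cosI a + cosI b = 0 -> sinI a + sinI b = 0 ->
  [/\ a != 0, b != 0 & (exists m n : int, a = m%:~R /\ b = n%:~R) \/
     (exists n : int, a = n%:~R / 2 /\ b = - (n%:~R / 2))].
Proof.
move=> c0 s0.
have nz x y : cosI x + cosI y = 0 -> sinI x + sinI y = 0 -> x != 0.
  move=> cxy sxy; apply/eqP => x0; move: cxy sxy; rewrite x0 cosI0 sinI0 => cy sy.
  have cy1 : cosI y = -1 by lra.
  have sy0 : sinI y = 0 by lra.
  have := sinIE y; have := cosIE y; rewrite cy1 sy0 mulr0 => sE cE.
  have := cos2Dsin2 (2 * pi * y).
  have -> : cos (2 * pi * y) = 1 by lra.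
  rewrite -sE mulrN1 sqrrN expr1n => /eqP.
  rewrite -subr_eq0 addrAC subrr add0r sqrf_eq0 => k0.
  have y0 : y = 0 by apply/eqP; apply: contraLR k0 => y0; exact: twopi_neq0.
  by move: cy1; rewrite y0 cosI0; lra.
have a0 := nz _ _ c0 s0.
have b0 : b != 0 by apply: (nz b a); rewrite addrC.
split => //.
have ka := twopi_neq0 a0; have kb := twopi_neq0 b0.
set k := 2 * pi * a in ka; set l := 2 * pi * b in kb.
have ca := cosIE a; have cb := cosIE b; have sa := sinIE a; have sb := sinIE b.
rewrite -/k -/l in ca cb sa sb.
have cbE : cosI b = - cosI a by lra.
have sbE : sinI b = - sinI a by lra.
set C := cosI a in cbE ca; set S := sinI a in sbE sa.
have ek : k * (C ^+ 2 + S ^+ 2) = 2 * S.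
  apply: (mulfI ka); have := cos2Dsin2 k; rewrite -ca.
  have -> : cos k = 1 - k * S by lra.
  by move=> e; lra.
have el : l * (C ^+ 2 + S ^+ 2) = - (2 * S).
  apply: (mulfI kb); have := cos2Dsin2 l; rewrite -cb cbE.
  have -> : cos l = 1 + l * S by rewrite sbE in sb; lra.
  by move=> e; lra.
have : (k + l) * (C ^+ 2 + S ^+ 2) = 0 by rewrite mulrDl ek el subrr.
move/eqP; rewrite mulf_eq0 => /orP[/eqP kl|].
  have lk : l = - k by lra.
  have C0 : C = 0.
    move: cb; rewrite cbE lk sinN -ca => kC.
    have : k * C = 0 by lra.
    by move/eqP; rewrite mulf_eq0 (negbTE ka) => /eqP.
  have [n nE] : exists n : int, k = n%:~R * pi.
    by apply: sin_eq0P; rewrite -ca C0 mulr0.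
  have aE : a = n%:~R / 2.
    apply: (mulfI (lt0r_neq0 (pi_gt0 R))).
    by move: nE; rewrite /k => nE; lra.
  right; exists n; split => //; rewrite -aE.
  apply: (mulfI (lt0r_neq0 (pi_gt0 R))).
  by move: lk; rewrite /k /l => lk; lra.
rewrite paddr_eq0 ?sqr_ge0// !sqrf_eq0 => /andP[/eqP C0 /eqP S0].
left.
have [m mE] : exists m : int, a = m%:~R.
  by apply: cos_eq1P; rewrite -/k; rewrite S0 in sa; lra.
have [n nE] : exists n : int, b = n%:~R.
  by apply: cos_eq1P; rewrite -/l; rewrite sbE S0 in sb; lra.
by exists m, n.
Qed.

End PlusFourier.

(** * Total families have no orthogonal unit vector *)

Section Bessel.
Context d (T : measurableType d) (R : realType).
Variable mu : {measure set T -> \bar R}.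
Hypothesis muT : mu setT = 1%E.

Definition unimodular (f : T -> R[i]) := cmeasurable f /\ forall x, sqn (f x) = 1.

Let mufin : (mu setT < +oo)%E.
Proof. by rewrite muT ltry. Qed.

Lemma cmeasurableJ (f : T -> R[i]) : cmeasurable f ->
  cmeasurable (fun x => conjc (f x)).
Proof.
move=> [fr fi]; split.
  rewrite (_ : _ \o _ = @complex.Re R \o f) //.
  by apply/funext => x /=; case: (f x).
rewrite (_ : _ \o _ = \- (@complex.Im R \o f)).
  exact: measurableT_comp (@oppr_measurable R setT) fi.
by apply/funext => x /=; case: (f x).
Qed.

Lemma sqnJ (z : R[i]) : sqn (conjc z) = sqn z.
Proof. by case: z => a b; rewrite /sqn /= sqrrN. Qed.

(** For p in the span, f is orthogonal to p, so integrating the inequality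
    |f - p| ^ 2 >= |f| ^ 2 - 2 Re (f conj(p)) shows that p stays at L^2 distance
    at least 1 from f. *)
Lemma not_dense_span_orthogonal (S : set (T -> R[i])) (f : T -> R[i]) :
  unimodular f -> S `<=` unimodular -> (forall s, S s -> inner mu f s = 0) ->
  ~ dense_span mu S.
Proof.
move=> [mf f1] uS fS dS.
pose re (p : T -> R[i]) x := complex.Re (f x * conjc (p x)).
pose im (p : T -> R[i]) x := complex.Im (f x * conjc (p x)).
have good p : span S p ->
    [/\ mu.-integrable setT (EFin \o re p), mu.-integrable setT (EFin \o im p),
        (\int[mu]_x re p x = 0)%R & (\int[mu]_x im p x = 0)%R].
  move: p; apply: span_ind.
    have re0 : re (fun=> 0) = cst 0 by apply/funext => x; rewrite /re conjc0 mulr0.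
    have im0 : im (fun=> 0) = cst 0 by apply/funext => x; rewrite /im conjc0 mulr0.
    rewrite re0 im0; split; try exact: integrable0;
      by rewrite Rintegral_cst// mul0r.
  move=> c s p Ss _ [irp iip rp ip].
  have [ms s1] := uS _ Ss.
  have mfs : cmeasurable (fun x => f x * conjc (s x)).
    by apply: cmeasurableM => //; exact: cmeasurableJ.
  have fs1 x : sqn (f x * conjc (s x)) = 1 by rewrite sqnM sqnJ f1 s1 mulr1.
  have irs : mu.-integrable setT (EFin \o re s).
    apply: (bounded_integrable mufin (M := 1)) => [|x]; first by case: mfs.
    exact: normr_Re_le1 (fs1 x).
  have iis : mu.-integrable setT (EFin \o im s).
    apply: (bounded_integrable mufin (M := 1)) => [|x]; first by case: mfs.
    exact: normr_Im_le1 (fs1 x).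
  have [rs is_] : (\int[mu]_x re s x = 0)%R /\ (\int[mu]_x im s x = 0)%R.
    by have := fS _ Ss; rewrite /inner /Cintegral => -[].
  have reE : re (fun x => c * s x + p x) = (fun x =>
      (complex.Re c * re s x + complex.Im c * im s x) + re p x).
    apply/funext => x; rewrite /re /im.
    case: (c) (f x) (s x) (p x) => [? ?] [? ?] [? ?] [? ?] /=.
    by ring.
  have imE : im (fun x => c * s x + p x) = (fun x =>
      (complex.Re c * im s x - complex.Im c * re s x) + im p x).
    apply/funext => x; rewrite /re /im.
    case: (c) (f x) (s x) (p x) => [? ?] [? ?] [? ?] [? ?] /=.
    by ring.
  have iZ (k : R) (h : T -> R) : mu.-integrable setT (EFin \o h) ->
      mu.-integrable setT (EFin \o (fun x => k * h x)).
    by move=> ih; exact: (integrableZl measurableT k ih).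
  have iD (g h : T -> R) : mu.-integrable setT (EFin \o g) ->
      mu.-integrable setT (EFin \o h) ->
      mu.-integrable setT (EFin \o (fun x => g x + h x)).
    by move=> ig ih; exact: (integrableD measurableT ig ih).
  have iB (g h : T -> R) : mu.-integrable setT (EFin \o g) ->
      mu.-integrable setT (EFin \o h) ->
      mu.-integrable setT (EFin \o (fun x => g x - h x)).
    by move=> ig ih; exact: (integrableB measurableT ig ih).
  rewrite reE imE; split.
  - by apply: (iD) => //; apply: (iD); exact: iZ.
  - by apply: (iD) => //; apply: (iB); exact: iZ.
  - rewrite RintegralD//; last by apply: (iD); exact: iZ.
    by rewrite RintegralD ?iZ// !RintegralZl// rs is_ rp !mulr0 !addr0.
  - rewrite RintegralD//; last by apply: (iB); exact: iZ.
    by rewrite RintegralB ?iZ// !RintegralZl// rs is_ ip !mulr0 subr0 addr0.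
have L2f : L2 mu f.
  split => //; rewrite L2norm_fin /energy; under eq_integral do rewrite f1.
  by rewrite integral_cst// mul1e.
have [n [c [s [Ss]]]] := dS f L2f 1 ltr01.
set p := fun x => \sum_(i < n) c i * s i x.
rewrite L2norm_lt// expr1n => fp1.
have Sp : span S p by exists n, c, s.
have [irp _ rp0 _] := good p Sp.
have mp : cmeasurable p.
  by apply: (span_cmeasurable _ Sp) => t /uS[].
have msq := cmeasurable_sqn (cmeasurableB mf mp).
have isq : mu.-integrable setT (EFin \o (fun x => sqn (f x - p x))).
  apply/integrableP; split; first exact/measurable_EFinP.
  under eq_integral do rewrite /= ger0_norm ?sqn_ge0//.
  by apply: (lt_trans fp1); rewrite ltry.
have i1 : mu.-integrable setT (EFin \o (fun=> 1 : R)).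
  by apply: (bounded_integrable mufin (M := 1)) => // x; rewrite normr1.
have i2 : mu.-integrable setT (EFin \o (fun x => 2 * re p x)).
  exact: (integrableZl measurableT 2 irp).
have : (\int[mu]_x (1 - 2 * re p x) <= \int[mu]_x sqn (f x - p x))%R.
  apply: le_Rintegral => //.
    exact: (integrableB measurableT i1 i2).
  move=> x _.
  have -> : sqn (f x - p x) = sqn (f x) - 2 * re p x + sqn (p x).
    by rewrite /re /sqn; case: (f x) (p x) => [a b] [u v] /=; ring.
  by rewrite f1 lerDl sqn_ge0.
rewrite RintegralB// RintegralZl// rp0 mulr0 subr0 Rintegral_cst// mul1r.
rewrite [X in fine X](_ : _ = 1%E)//= leNgt => /negP; apply.
by rewrite -lte_fin /Rintegral fineK// integrable_fin_num.
Qed.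

End Bessel.

(** * Characters on the two segments *)

Section PlusCharacters.
Variable R : realType.
Local Notation RR := (measurableTypeR R).
Implicit Types l : R * R.

Lemma unimodular_echar l : unimodular (echar l : RR * RR -> R[i]).
Proof.
split; last by move=> z; exact: sqn_expi.
apply: cmeasurable_expi; apply: measurable_funM; first exact: measurable_cst.
by apply: measurable_funD; apply: measurable_funM => //; exact: measurable_cst.
Qed.

Lemma echarB l l' z : echar l z * conjc (echar l' z) = echar (l - l') z.
Proof.
by rewrite /echar -expiN -expiD; congr expi; rewrite /=; ring.
Qed.

Lemma inner_echar l l' : inner (rho R) (echar l) (echar l') =
  Complex ((cosI (l - l').1 + cosI (l - l').2) / 2)
          ((sinI (l - l').1 + sinI (l - l').2) / 2).
Proof.
rewrite /inner (_ : (fun x => _) = echar (l - l')); last first.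
  by apply/funext => z; exact: echarB.
have [[mr mi] _] := unimodular_echar (l - l').
rewrite /Cintegral (Rintegral_rho (M := 1) mr); last by move=> z; exact: cos_max.
rewrite (Rintegral_rho (M := 1) mi); last by move=> z; exact: sin_max.
congr (Complex ((_ + _) / 2) ((_ + _) / 2)); apply: eq_Rintegral => x _ /=;
  by congr (_ _); ring.
Qed.

Lemma inner_echar_self l : inner (rho R) (echar l) (echar l) = 1.
Proof.
rewrite inner_echar subrr /= cosI0 sinI0 addr0 mul0r.
by apply/eqP; rewrite eq_complex /= eqxx andbT; apply/eqP; lra.
Qed.

(** If two characters agree almost everywhere, their inner product is 1; but
    this is the mean of two numbers that are less than 1 unless the
    corresponding frequency difference vanishes. *)
Lemma echar_ae_inj l l' :
  (echar l : RR * RR -> R[i]) = echar l' %[ae rho R] -> l = l'.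
Proof.
move=> ll'.
have : inner (rho R) (echar l) (echar l') = inner (rho R) (echar l) (echar l).
  rewrite /inner /Cintegral /Rintegral.
  have [mr mi] : cmeasurable (fun z : RR * RR => echar l z * conjc (echar l' z)).
    apply: cmeasurableM; first exact: (unimodular_echar l).1.
    exact: cmeasurableJ (unimodular_echar l').1.
  have [nr ni] : cmeasurable (fun z : RR * RR => echar l z * conjc (echar l z)).
    apply: cmeasurableM; first exact: (unimodular_echar l).1.
    exact: cmeasurableJ (unimodular_echar l).1.
  have eJ z : echar l z = echar l' z ->
      echar l z * conjc (echar l' z) = echar l z * conjc (echar l z) by move=> ->.
  congr (Complex (fine _) (fine _)); apply: ae_eq_integral => //;
    try exact/measurable_EFinP; apply: filterS ll' => z /(_ I) /eJ e _.
    exact: (congr1 (fun w => (complex.Re w)%:E) e).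
  exact: (congr1 (fun w => (complex.Im w)%:E) e).
rewrite inner_echar_self inner_echar => -[c1 _].
set a := (l - l').1 in c1; set b := (l - l').2 in c1.
have cle x : cosI x <= 1 :> R.
  by have [->|/cosI_lt1/ltW//] := eqVneq x 0; rewrite cosI0.
have a0 : a = 0.
  by apply/eqP; apply: contraT => /cosI_lt1 ca; have := cle b; lra.
have b0 : b = 0.
  by apply/eqP; apply: contraT => /cosI_lt1 ca; have := cle a; lra.
apply/eqP; rewrite -subr_eq0; apply/eqP; move: a0 b0; rewrite /a /b.
by case: (l - l') => x y /= -> ->.
Qed.

(** Constant on each segment with opposite signs: orthogonal to the constants,
    and to all characters whose frequencies are nonzero integers. *)
Definition axis_sign (z : RR * RR) : R[i] := if z.2 == 0 then 1 else -1.

Lemma unimodular_axis_sign : unimodular axis_sign.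
Proof.
have m2 : measurable ([set z : RR * RR | z.2 = 0]).
  rewrite (_ : [set z | _] = setT `&` snd @^-1` [set 0]); last by rewrite setTI.
  by apply: (@measurable_snd _ _ RR RR).
split; last first.
  by move=> z; rewrite /axis_sign; case: ifP; rewrite /sqn /=; move=> _; ring.
rewrite (_ : axis_sign = fun z =>
    (2 * \1_[set z : RR * RR | z.2 = 0] z - 1)%:C%C).
  apply: cmeasurable_real; apply: measurable_funB; last exact: measurable_cst.
  by apply: measurable_funM; [exact: measurable_cst|exact: measurable_indic].
apply/funext => z; rewrite /axis_sign indicE; case: eqP => z2.
  by rewrite mem_set//= mulr1; congr Complex; ring.
by rewrite memNset//= mulr0 sub0r; congr Complex; ring.
Qed.

(** The point 0 is left out because both segments contain the origin, where
    [axis_sign] takes the value of the horizontal one. *)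
Lemma Rintegral01_eq (f g : R -> R) : continuous g ->
  (forall x, 0 < x -> f x = g x) ->
  (\int[lebesgue_measure]_(x in `[0, 1]) f x =
   \int[lebesgue_measure]_(x in `[0, 1]) g x)%R.
Proof.
move=> cg fg.
have ig : lebesgue_measure.-integrable `]0, 1] (EFin \o g).
  by apply: (integrableS _ _ _ (integrable01_continuous cg)) => //;
    exact: subset_itv_oc_cc.
have eqfg : {in `]0, 1]%classic, EFin \o g =1 EFin \o f}.
  by move=> x; rewrite inE /= in_itv /= => /andP[x0 _]; rewrite fg.
have if_ : lebesgue_measure.-integrable `]0, 1] (EFin \o f).
  by apply: eq_integrable ig.
rewrite -!Rintegral_itv_obnd_cbnd//; apply: eq_Rintegral => x /eqfg /=.
by case.
Qed.

Lemma inner_axis_sign l : inner (rho R) axis_sign (echar l) =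
  Complex ((cosI l.1 - cosI l.2) / 2) ((sinI l.2 - sinI l.1) / 2).
Proof.
have [mf f1] : unimodular (fun z : RR * RR => axis_sign z * conjc (echar l z)).
  have [ma a1] := unimodular_axis_sign; have [me e1] := unimodular_echar l.
  split; first by apply: cmeasurableM => //; exact: cmeasurableJ.
  by move=> z; rewrite sqnM sqnJ a1 e1 mulr1.
have [mr mi] := mf.
rewrite /inner /Cintegral (Rintegral_rho (M := 1) mr); last first.
  by move=> z; exact: normr_Re_le1 (f1 z).
rewrite (Rintegral_rho (M := 1) mi); last first.
  by move=> z; exact: normr_Im_le1 (f1 z).
have cc (k : R) := continuous_scale (k := k) (@continuous_cos R).
have cs (k : R) := continuous_scale (k := k) (@continuous_sin R).
have cN (g : R -> R) : continuous g -> continuous (fun x => -1 * g x).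
  by move=> cg x; apply: cvgM; [exact: cvg_cst|exact: cg].
have IN (g : R -> R) : continuous g ->
    - (\int[lebesgue_measure]_(x in `[0, 1]) g x)%R =
    (\int[lebesgue_measure]_(x in `[0, 1]) (-1 * g x))%R.
  by move=> cg; rewrite RintegralZl// ?mulN1r//; exact: integrable01_continuous.
have e1 x : 2 * pi * (l.1 * x + l.2 * 0) = 2 * pi * l.1 * x by ring.
have e2 x : 2 * pi * (l.1 * 0 + l.2 * x) = 2 * pi * l.2 * x by ring.
rewrite [sinI _ - _]addrC /cosI /sinI !IN//.
congr (Complex ((_ + _) / 2) ((_ + _) / 2)); apply: Rintegral01_eq => //;
  try exact: cN; move=> x x0;
  rewrite /axis_sign /echar /expi /= ?eqxx ?(gt_eqF x0) /=;
  rewrite ?e1 ?e2; ring.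
Qed.

End PlusCharacters.

(** * Spectra containing the origin *)

Section Spectrum.
Variable R : realType.
Implicit Types (L : set (R * R)) (l : R * R).

Lemma cosI_half (n : int) : n != 0 -> cosI (n%:~R / 2) = 0 :> R.
Proof.
move=> n0; have h0 : n%:~R / 2 != 0 :> R by rewrite mulf_neq0 ?intr_eq0.
apply: (mulfI (twopi_neq0 h0)); rewrite cosIE mulr0.
by rewrite (_ : 2 * pi * _ = n%:~R * pi) ?sin_mulz_pi//; field.
Qed.

Lemma cosIN (a : R) : cosI (- a) = cosI a.
Proof.
have [->|a0] := eqVneq a 0; first by rewrite oppr0.
have Na0 : - a != 0 by rewrite oppr_eq0.
apply: (mulfI (twopi_neq0 Na0)); rewrite cosIE.
by rewrite mulrN mulNr cosIE sinN.
Qed.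

Lemma antidiagonal_subr (l l' : R * R) : antidiagonal l -> antidiagonal l' ->
  antidiagonal (l - l').
Proof.
move=> [m _ <-] [n _ <-]; exists (m - n) => //.
by rewrite intrB; congr pair; rewrite /=; lra.
Qed.

Lemma antidiagonal_addr (l l' : R * R) : antidiagonal l -> antidiagonal l' ->
  antidiagonal (l + l').
Proof.
move=> [m _ <-] [n _ <-]; exists (m + n) => //.
by rewrite intrD; congr pair; rewrite /=; lra.
Qed.

Lemma inner_antidiagonal l l' : antidiagonal l -> antidiagonal l' -> l != l' ->
  inner (rho R) (echar l) (echar l') = 0.
Proof.
move=> Dl Dl' ll'; rewrite inner_echar.
have [n _ nE] := antidiagonal_subr Dl Dl'.
have n0 : n != 0.
  apply: contra ll' => /eqP n0; rewrite -subr_eq0 -nE n0 mul0r oppr0.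
  exact/eqP.
by rewrite -nE /= cosIN sinIN cosI_half// subrr addr0 mul0r.
Qed.

Lemma orthonormal_antidiagonal : Defs.orthonormal (rho R) (E (@antidiagonal R)).
Proof.
split.
- move=> _ [l _ <-]; have [ml l1] := unimodular_echar l; split => //.
  rewrite L2norm_fin /energy; under eq_integral do rewrite l1.
  by rewrite integral_cst// mul1e rho_fin.
- by move=> _ [l _ <-]; exact: inner_echar_self.
- move=> _ _ [l Dl <-] [l' Dl' <-] ll'; apply: inner_antidiagonal => //.
  by apply/eqP => ll; apply: ll'; rewrite ll; apply: aeW.
Qed.

Lemma orthonormal_difference L l l' : Defs.orthonormal (rho R) (E L) ->
  L l -> L l' -> l != l' ->
  [/\ (l - l').1 != 0, (l - l').2 != 0 &
      (exists m n : int, l - l' = (m%:~R, n%:~R)) \/ antidiagonal (l - l')].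
Proof.
move=> [_ _ orth] Ll Ll' ll'.
have : inner (rho R) (echar l) (echar l') = 0.
  apply: orth; [by exists l|by exists l'|move=> /echar_ae_inj ll].
  by rewrite ll eqxx in ll'.
rewrite inner_echar => -[c0 s0].
have [||a0 b0 ab] := @orthogonal_frequencies R (l - l').1 (l - l').2.
- by apply: (mulIf (x := 2^-1)); rewrite ?mul0r// invr_eq0.
- by apply: (mulIf (x := 2^-1)); rewrite ?mul0r// invr_eq0.
split => //; case: ab => [[m [n [am bn]]]|[n [an bn]]]; [left|right].
  by exists m, n; rewrite -am -bn; case: (l - l').
by exists n => //; rewrite -bn -an; case: (l - l').
Qed.

(** Otherwise [axis_sign] is orthogonal to the whole family: over [0, 1], the
    exponentials with nonzero integer frequency have mean 0, and the frequency
    (0, 0) sees the two segments cancel. *)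
Lemma exists_noninteger L : L (0, 0) -> orthonormal_basis (rho R) (E L) ->
  exists2 l, L l & ~ exists m n : int, l = (m%:~R, n%:~R).
Proof.
move=> L0 [orth dense]; apply: contrapT => noL.
have intL l : L l -> exists m n : int, l = (m%:~R, n%:~R).
  by move=> Ll; apply: contrapT => nl; apply: noL; exists l.
have cosI_int (m : int) : m%:~R != 0 :> R -> cosI m%:~R = 0 :> R.
  move=> m0; have -> : m%:~R = (2 * m)%:~R / 2 :> R by rewrite intrM; field.
  by apply: cosI_half; rewrite mulf_neq0// -(@intr_eq0 R).
have sinI_int (m : int) : m%:~R != 0 :> R -> sinI m%:~R = 0 :> R.
  move=> m0; apply: (mulfI (twopi_neq0 m0)); rewrite sinIE mulr0.
  have -> : 2 * pi * m%:~R = m%:~R * pi + m%:~R * pi :> R by ring.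
  by rewrite cosD -!expr2 cos2sin2 sin_mulz_pi expr0n /= !subr0 subrr.
apply: (not_dense_span_orthogonal (rhoT R) (unimodular_axis_sign R) _ _ dense).
  by move=> _ [l _ <-]; exact: unimodular_echar.
move=> _ [l Ll <-]; rewrite inner_axis_sign.
have [->|l0] := eqVneq l (0, 0); first by rewrite !subrr mul0r.
have [] := orthonormal_difference orth Ll L0 l0.
have [m [n lE]] := intL l Ll.
rewrite -[(0, 0)]/(0 : R * R) subr0 lE /= => m0 n0 _.
by rewrite !cosI_int// !sinI_int// !subrr mul0r.
Qed.

(** Fix a noninteger frequency l0; orthogonality to the constants puts it on
    the antidiagonal.  An integer pair l differs from l0 by a noninteger pair,
    so orthogonality of l and l0 makes l - l0, and then l, antidiagonal. *)
Lemma spectrum_sub_antidiagonal L : L (0, 0) ->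
  orthonormal_basis (rho R) (E L) -> L `<=` @antidiagonal R.
Proof.
move=> L0 basis; have [l0 Ll0 nint] := exists_noninteger L0 basis.
have [orth dense] := basis.
have D0 : antidiagonal (0 : R * R) by exists 0 => //; rewrite mul0r oppr0.
have Dl0 : antidiagonal l0.
  have l00 : l0 != (0, 0).
    by apply/eqP => l00; apply: nint; exists 0, 0; rewrite l00.
  have [_ _] := orthonormal_difference orth Ll0 L0 l00.
  by rewrite -[(0, 0)]/(0 : R * R) subr0; case.
move=> l Ll; have [->//|ll0] := eqVneq l l0.
have [->//|l0'] := eqVneq l (0, 0).
have [_ _] := orthonormal_difference orth Ll L0 l0'.
rewrite -[(0, 0)]/(0 : R * R) subr0 => -[[m [n lE]]|//].
have [_ _ [[p [q dE]]|Dd]] := orthonormal_difference orth Ll Ll0 ll0.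
  exfalso; apply: nint; exists (m - p), (n - q).
  by rewrite !intrB -[l0](subKr l) dE lE.
by rewrite -(subrK l0 l); exact: antidiagonal_addr.
Qed.

End Spectrum.

Theorem theorem1p3 (R : realType) (L : set (R * R)) :
  [/\ countable L, L (0, 0) & orthonormal_basis (rho R) (E L)] <->
  L = [set (n%:~R / 2, - (n%:~R / 2)) | n in [set: int]].
Proof.
split=> [[_ L0 basis]|->].
  have LD := spectrum_sub_antidiagonal L0 basis.
  apply/seteqP; split => // l Dl; apply: contrapT => nLl.
  have [_ dense] := basis.
  apply: (not_dense_span_orthogonal (rhoT R) (unimodular_echar l) _ _ dense).
    by move=> _ [k _ <-]; exact: unimodular_echar.
  move=> _ [k Lk <-]; apply: inner_antidiagonal => //; first exact: LD.
  by apply/eqP => lk; apply: nLl; rewrite lk.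
split.
- by apply: sub_countable (card_image_le _ _) _; exact: countableP.
- by exists 0 => //; rewrite mul0r oppr0.
- by split; [exact: orthonormal_antidiagonal|exact: antidiagonal_dense].
Qed.
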